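(* The elements $E_i,F_i$ ($i\in[1,n-1]$), $H_a^{\pm}$ ($a\in[1,n]$) and $L$ generate the algebra $\mathbb{Q}(v)\otimes_{\mathcal{A}}\mathcal{MS}_{n,d}$.
   Context: Let $v$ be an indeterminate, $\mathcal{A}=\mathbb{Z}[v,v^{-1}]$, $n,d$ positive integers, $[a,b]$ the set of integers between $a$ and $b$, $\mathbb{N}=\{0,1,\dots\}$, $E_{k,l}$ the $n\times n$ matrix units. $\Xi_{n|n,d}$ is the set of decorated matrices $(A,\Delta)$: $A=(a_{ij})$ is an $n\times n$ matrix over $\mathbb{N}$ with entries summing to $d$, and $\Delta=\{(i_1,j_1),\dots,(i_k,j_k)\}$ is a (possibly empty) set of positions with $i_1<\cdots<i_k$, $j_1>\cdots>j_k$ and $a_{ij}>0$ for all $(i,j)\in\Delta$. For a prime power $q$ let $V=\mathbb{F}_q^d$, $G=GL_d(\mathbb{F}_q)$, $\mathscr{X}$ the set of flags $(0=V_0\subseteq V_1\subseteq\cdots\subseteq V_n=V)$ (inclusions not necessarily strict). The $G$-orbits on $\mathscr{X}\times\mathscr{X}\times V$ are the sets $\mathcal{O}_{A,\Delta}$, $(A,\Delta)\in\Xi_{n|n,d}$, consisting of the triples $((V_i),(V'_j),\omega)$ for which $V$ has a basis $\{e^s_{ij}:1\le s\le a_{ij}\}$ with $V_i=\mathrm{span}\{e^s_{i'j}:i'\le i\}$, $V'_j=\mathrm{span}\{e^s_{ij'}:j'\le j\}$, $\omega=\sum_{(i,j)\in\Delta}e^1_{ij}$. $\mathcal{MS}_{n,d}$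 is the free $\mathcal{A}$-module on the characteristic functions $e_{A,\Delta}$ with convolution product $(g*h)(f,f',\omega)=\sum_{f''\in\mathscr{X},\mu\in V}g(f,f'',\mu)h(f'',f',\omega-\mu)$ in the generic sense (structure constants in $\mathcal{A}$ specializing at $v=\sqrt q$ to those of the convolution, for every prime power $q$). Put $[A]_\Delta=v^{-N(A,\Delta)}e_{A,\Delta}$, where $N(A,\Delta)=\sum_{i\ge k,\,j<l}a_{ij}a_{kl}+\sum_{(i,j)\le\Delta}a_{ij}$ and $(i,j)\le\Delta$ means that there is $(k,l)\in\Delta$ with $i\le k$ and $j\le l$. Define $$E_i=\sum_B[B]_\emptyset,\quad F_i=\sum_C[C]_\emptyset,\quad H_a^{\pm}=\sum_D v^{\mp d_{aa}}[D]_\emptyset,\quad L=\sum_D v^{-2d_{11}}[D]_\emptyset+\sum_{D'}v^{-d'_{11}}[D']_{\{(1,1)\}},$$ where $B,C,D,D'$ run over all matrices with $(B,\emptyset),(C,\emptyset),(D,\emptyset),(D',\{(1,1)\})\in\Xi_{n|n,d}$ such that $B-E_{i,i+1}$, $C-E_{i+1,i}$, $D$, $D'$ are diagonal (so $d'_{11}>0$). *)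

(* Defs.v *)
From HB Require Import structures.
From mathcomp Require Import all_boot all_order all_algebra all_field finmap.

Set Implicit Arguments.
Unset Strict Implicit.
Unset Printing Implicit Defensive.

Import Order.TTheory GRing.Theory Num.Theory VectorInternalTheory.
Local Open Scope ring_scope.

(* Positions are 0-based: the row or column a of [1,n] is the element a-1 of
   'I_n.  Entries are stored in 'I_d.+1, which is no restriction since they sum
   to d, and makes the set of decorated matrices a finType. *)
Definition decorated (n d : nat)
    (X : 'M['I_d.+1]_n * {set 'I_n * 'I_n}) : bool :=
  [&& (\sum_i \sum_j (X.1 i j : nat) == d)%N,
      [forall p in X.2, 0 < (X.1 p.1 p.2 : nat)]%N
    & [forall p in X.2, forall r in X.2, (p != r) ==>
        (((p.1 < r.1) && (r.2 < p.2)) || ((r.1 < p.1) && (p.2 < r.2)))%N]].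

Definition Xi (n d : nat) : finType :=
  {X : 'M['I_d.+1]_n * {set 'I_n * 'I_n} | decorated X}.

Section DecoratedMatrices.
Variables n d : nat.
Implicit Type X : Xi n d.

Definition entry X (i j : 'I_n) : nat := (val X).1 i j.
Definition decor X : {set 'I_n * 'I_n} := (val X).2.

Definition intmx X : 'M[int]_n := \matrix_(i, j) (entry X i j)%:Z.

Definition below_decor X (i j : 'I_n) : bool :=
  [exists p in decor X, (i <= p.1) && (j <= p.2)]%N.

Definition Nexp X : nat :=
  (\sum_(i < n) \sum_(j < n) \sum_(k < n | k <= i) \sum_(l < n | j < l)
     entry X i j * entry X k l
   + \sum_(i < n) \sum_(j < n | below_decor X i j) entry X i j)%N.

End DecoratedMatrices.

HB.instance Definition _ (F : finFieldType) (vT : vectType F) :=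
  [Countable of {vspace vT} by <:].
HB.instance Definition _ (F : finFieldType) (vT : vectType F) :=
  [Finite of {vspace vT} by <:].

Section Orbits.
Variables (F : finFieldType) (n d : nat).

Definition is_flag (f : {ffun 'I_n.+1 -> {vspace 'rV[F]_d}}) : bool :=
  [&& f ord0 == 0%VS, f ord_max == fullv
    & [forall i : 'I_n.+1, forall j : 'I_n.+1, (i <= j)%N ==> (f i <= f j)%VS]].

Definition flag : finType :=
  {f : {ffun 'I_n.+1 -> {vspace 'rV[F]_d}} | is_flag f}.

(* [Tagged _ s : bidx X] with tag (i, j) indexes the basis vector e_{ij}^{s+1}. *)
Definition bidx (X : Xi n d) : finType :=
  {p : 'I_n * 'I_n & 'I_(entry X p.1 p.2)}.

(* Because of 0-based positions, the row condition i' <= i on rows of [1,n]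
   reads (tag x).1 < i, the flag index i ranging over [0,n]. *)
Definition adapted (X : Xi n d) (f f' : flag) (w : 'rV[F]_d)
    (b : {ffun bidx X -> 'rV[F]_d}) : bool :=
  [&& basis_of fullv [seq b x | x : bidx X],
      [forall i : 'I_n.+1, sval f i ==
         <<[seq b x | x : bidx X in [pred x : bidx X | (tag x).1 < i]%N]>>%VS],
      [forall j : 'I_n.+1, sval f' j ==
         <<[seq b x | x : bidx X in [pred x : bidx X | (tag x).2 < j]%N]>>%VS]
    & w == \sum_(x : bidx X | (tag x \in decor X) && (tagged x == 0%N :> nat)) b x].

Definition in_orbit (X : Xi n d) (f f' : flag) (w : 'rV[F]_d) : bool :=
  [exists b : {ffun bidx X -> 'rV[F]_d}, adapted f f' w b].

Definition char_fun (X : Xi n d) (f f' : flag) (w : 'rV[F]_d) : algC :=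
  (in_orbit X f f' w)%:R.

Definition convolution (g h : flag -> flag -> 'rV[F]_d -> algC)
    (f f' : flag) (w : 'rV[F]_d) : algC :=
  \sum_(f'' : flag) \sum_(m : 'rV[F]_d) g f f'' m * h f'' f' (w - m).

End Orbits.

(* Z[v, 1/v]: p is the Laurent polynomial whose coefficient of v^k is p k. *)
Definition laurent : Type := {fsfun int -> int with 0}.

Definition laurent_eval (K : fieldType) (x : K) (p : laurent) : K :=
  \sum_(k <- finsupp p) (p k)%:~R * x ^ k.

Definition Qv : fieldType := {fraction {poly rat}}.
Definition v : Qv := tofrac 'X.

(* c X Y Z is the coefficient of e_Z in e_X * e_Y.  This determines c: the orbits
   are nonempty and disjoint, and a Laurent polynomial is determined by its values
   at the sqrt q. *)
Definition generic_structure (n d : nat)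
    (c : Xi n d -> Xi n d -> Xi n d -> laurent) : Prop :=
  forall (F : finFieldType) (X Y : Xi n d) (f f' : flag F n d) (w : 'rV[F]_d),
    convolution (@char_fun F n d X) (@char_fun F n d Y) f f' w =
    \sum_Z laurent_eval (sqrtC #|F|%:R) (c X Y Z) * char_fun Z f f' w.

(* The scalar extension of MS_{n,d} to Q(v), in coordinates for the basis e_X. *)
Definition MSv (n d : nat) : vectType Qv := {ffun Xi n d -> Qv^o}.

Section Algebra.
Variables n d : nat.
Implicit Types X Y Z : Xi n d.

Definition e_ X : MSv n d := [ffun Y => (Y == X)%:R].

Definition MSmul (c : Xi n d -> Xi n d -> Xi n d -> laurent)
    (x y : MSv n d) : MSv n d :=
  \sum_X \sum_Y \sum_Z (x X * y Y * laurent_eval v (c X Y Z)) *: e_ Z.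

Definition std X : MSv n d := v ^- Nexp X *: e_ X.

(* genEF i j is E_a if (i, j) = (a, a+1) and F_a if (i, j) = (a+1, a). *)
Definition genEF (i j : 'I_n) : MSv n d :=
  \sum_(X | (decor X == set0) && is_diag_mx (intmx X - delta_mx i j)) std X.

Definition genH (eps : int) (a : 'I_n) : MSv n d :=
  \sum_(X | (decor X == set0) && is_diag_mx (intmx X))
     v ^ (- eps * (entry X a a)%:Z) *: std X.

Definition genL (o : 'I_n) : MSv n d :=
  \sum_(X | (decor X == set0) && is_diag_mx (intmx X))
     v ^- (2 * entry X o o) *: std X
  + \sum_(X | (decor X == [set (o, o)]) && is_diag_mx (intmx X))
     v ^- entry X o o *: std X.

Variant generator : MSv n d -> Prop :=
| GenE (i j : 'I_n) of j = i.+1 :> nat : generator (genEF i j)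
| GenF (i j : 'I_n) of j = i.+1 :> nat : generator (genEF j i)
| GenHplus (a : 'I_n) : generator (genH 1 a)
| GenHminus (a : 'I_n) : generator (genH (-1) a)
| GenL (o : 'I_n) of o = 0%N :> nat : generator (genL o).

(* The only subspace closed under products and containing the set is the whole
   space.  Membership of the unit is not required of U: the unit of MSv is the
   product of genH 1 a and genH (-1) a. *)
Definition generates (mul : MSv n d -> MSv n d -> MSv n d)
    (gen : MSv n d -> Prop) : Prop :=
  forall U : {vspace MSv n d},
    (forall x, gen x -> x \in U) ->
    (forall x y, x \in U -> y \in U -> mul x y \in U) ->
    U = fullv.

End Algebra.

(* Main.v *)
(* Let U be a subspace closed under products and containing the generators.  As
   the structure constants specialize to numbers of configurations (f'', mu), a
   coefficient of e_X e_Y is nonzero over Q(v) exactly when a configuration exists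
   over some finite field.  Hence, if e_X and e_Y are in U and all but one of the
   basis elements occurring in e_X e_Y are in U, then so is the last one.

   The H's separate the diagonal idempotents e_D, which cut the E's, F's and L
   into single basis elements.  Two inductions produce all the others.
   - The diagonal e_{D,{(i,i)}} are obtained by induction on i: e_{D,{(i+1,i+1)}}
     occurs in e_C e_{B,{(i,i+1)}}, where C - E_{i+1,i} and B - E_{i,i+1} are
     diagonal, and the other terms have at most the off-diagonal entries
     a_{i,i+1} = a_{i+1,i} = 1.
   - A general (A,Delta) is reached by induction on the sum of a_ij (i - j)^2 and,
     for fixed A, on the order ideal generated by Delta.  By transposition A may be
     assumed to have an entry above the diagonal.  Take such a position (h,j) with
     h maximal.  If it is not in Delta, then (A,Delta) is the leading term of the
     product of some e_B, B - E_{h,h+1} diagonal, with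
     e_{A - E_{hj} + E_{h+1,j}, Delta}.  Otherwise the positions above the diagonal
     in the leftmost possible column are dominated by an element of Delta, and one
     multiplies on the right instead. *)

Require Import Defs.
From mathcomp Require Import all_boot all_order all_algebra all_field finmap.
From mathcomp Require Import zify.
Import Defs.
Set Implicit Arguments.
Unset Strict Implicit.
Unset Printing Implicit Defensive.
Import Order.TTheory GRing.Theory Num.Theory.
Local Open Scope ring_scope.

(** * Spans of parts of a basis *)

Section BasisSpans.
Variables (F : fieldType) (vT : vectType F) (I : finType) (b : I -> vT).
Hypothesis b_basis : basis_of fullv [seq b x | x : I].

Definition bspan (Q : pred I) : {vspace vT} := <<[seq b x | x : I in Q]>>%VS.

Let B : #|I|.-tuple vT := codom_tuple b.
Definition bcoord (x : I) : vT -> F := coord B (enum_rank x).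

Let nthB (i : 'I_#|I|) : B`_i = b (enum_val i).
Proof. exact: nth_codom. Qed.

Lemma bcoordE x y : bcoord x (b y) = (x == y)%:R.
Proof.
rewrite /bcoord -[y in LHS](enum_rankK y) -nthB coord_free ?(basis_free b_basis) //.
by rewrite (inj_eq enum_rank_inj) eq_sym.
Qed.

Lemma bcoord_sum v : v = \sum_x bcoord x v *: b x.
Proof.
rewrite [LHS](coord_basis b_basis (memvf v)).
rewrite (reindex (@enum_val I I)); last first.
  by apply: onW_bij; exact: enum_val_bij.
by apply: eq_bigr => i _; rewrite /bcoord enum_valK -nthB.
Qed.

Lemma bcoord_add_sum (x : I) (J : finType) (R : pred J) (u : J -> vT) :
  bcoord x (\sum_(j | R j) u j) = \sum_(j | R j) bcoord x (u j).
Proof. by rewrite /bcoord linear_sum. Qed.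

(** Coordinates turn membership into a condition on labels, so that sums and intersections of such
    spans become unions and intersections of sets of labels. *)
Lemma mem_bspan (Q : pred I) v :
  (v \in bspan Q) = [forall x, ~~ Q x ==> (bcoord x v == 0)].
Proof.
apply/idP/forallP => [vQ x|H].
  apply/implyP => nQx.
  have: v \in <<in_tuple [seq b x | x : I in Q]>>%VS by [].
  move=> /coord_span ->; rewrite bcoord_add_sum big1 // => i _.
  rewrite /bcoord linearZ /= -/(bcoord x _).
  have /mapP[y yQ ->] := mem_nth 0 (ltn_ord i).
  rewrite bcoordE; case: eqP => [exy|_]; last by rewrite mulr0.
  by move: yQ; rewrite mem_enum -exy unfold_in (negPf nQx).
rewrite (bcoord_sum v); apply: memv_suml => x _.
case Qx: (Q x); last by move: (H x); rewrite Qx /= => /eqP ->; rewrite scale0r mem0v.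
by apply/memvZ/memv_span/map_f; rewrite mem_enum.
Qed.

Lemma mem_bspan_sum (K : {set I}) (Q : pred I) :
  (\sum_(x in K) b x \in bspan Q) = [forall x in K, Q x].
Proof.
have bcK x : bcoord x (\sum_(y in K) b y) = (x \in K)%:R.
  rewrite bcoord_add_sum; case xK: (x \in K).
    rewrite (bigD1 x) //= bcoordE eqxx big1 ?addr0 // => y /andP[_ yx].
    by rewrite bcoordE eq_sym (negPf yx).
  rewrite big1 // => y yK; rewrite bcoordE; case: eqP => // exy.
  by rewrite exy yK in xK.
rewrite mem_bspan; apply: eq_forallb => x; rewrite bcK.
by case: (x \in K); case: (Q x) => //=; rewrite ?oner_eq0 ?eqxx.
Qed.

Lemma eq_bspan (Q1 Q2 : pred I) : Q1 =1 Q2 -> bspan Q1 = bspan Q2.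
Proof.
by move=> eQ; apply/vspaceP => v; rewrite !mem_bspan; apply: eq_forallb => x; rewrite eQ.
Qed.

Lemma bspan_sub (Q1 Q2 : pred I) : subpred Q1 Q2 -> (bspan Q1 <= bspan Q2)%VS.
Proof.
move=> sQ; apply/subvP => v; rewrite !mem_bspan => /forallP H.
by apply/forallP => x; apply/implyP => nQ; apply: (implyP (H x)); apply: contra nQ; exact: sQ.
Qed.

Lemma mem_bspan1 (Q : pred I) x : Q x -> b x \in bspan Q.
Proof. by move=> Qx; apply/memv_span/map_f; rewrite mem_enum. Qed.

Lemma bspanI (Q1 Q2 : pred I) : (bspan Q1 :&: bspan Q2)%VS = bspan (predI Q1 Q2).
Proof.
apply/vspaceP => v; rewrite memv_cap !mem_bspan.
apply/andP/forallP => [[/forallP H1 /forallP H2] x|H].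
  move: (H1 x) (H2 x); rewrite /=; case: (Q1 x) => //=.
split; apply/forallP => x; move: (H x) => /=; case: (Q1 x); case: (Q2 x) => //=.
Qed.

Lemma bspan_sum (J : finType) (R : pred J) (Q : J -> pred I) :
  (\sum_(j | R j) bspan (Q j))%VS = bspan [pred x | [exists j, R j && Q j x]].
Proof.
apply/vspaceP => v; apply/idP/idP.
  apply/subvP: v; apply/subv_sumP => j Rj; apply: bspan_sub => x Qx /=.
  by apply/existsP; exists j; rewrite Rj.
rewrite mem_bspan => /forallP H.
rewrite (bcoord_sum v); apply: memv_suml => x _.
have [/existsP[j /andP[Rj Qx]]|nx] := boolP [exists j, R j && Q j x].
  apply: memvZ; apply: (subvP (sumv_sup j Rj (subvv _))); exact: mem_bspan1.
by move: (H x); rewrite /= nx => /eqP ->; rewrite scale0r mem0v.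
Qed.

Lemma bspanD (Q1 Q2 : pred I) : (bspan Q1 + bspan Q2)%VS = bspan (predU Q1 Q2).
Proof.
rewrite -(big_bool _ (fun c => bspan (if c then Q1 else Q2))).
rewrite bspan_sum; apply: eq_bspan => x /=.
apply/existsP/orP => [[[] /= H]|[H|H]]; [left|right|exists true|exists false] => //.
Qed.

Lemma dim_bspan (Q : pred I) : \dim (bspan Q) = #|Q|.
Proof.
have fr : free [seq b x | x : I in Q].
  have := basis_free b_basis.
  have eE : enum Q = filter Q (enum I) by rewrite [in RHS]enumT; apply: eq_filter.
  rewrite -(perm_free (perm_map b (permEl (perm_filterC Q (enum I))))).
  by rewrite map_cat -eE => /catl_free.
by rewrite (eqP fr) size_image.
Qed.

Lemma bspanT : bspan predT = fullv.
Proof. by apply/vspaceP => v; rewrite mem_bspan memvf; apply/forallP. Qed.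

Lemma bspan0 : bspan pred0 = 0%VS.
Proof. by apply/eqP; rewrite -dimv_eq0 dim_bspan card0. Qed.

End BasisSpans.

(** * Orbits in terms of labelled bases *)

Section Charts.
Variables (F : finFieldType) (n d : nat).
Local Notation V := 'rV[F]_d.
Local Notation flag := (flag F n d).
Implicit Types (f : flag) (w : V) (X : Xi n d).

(** Indexing by [nat] makes [k.+1] available without casts. Since [inord] is faithful only up to
    [n], most lemmas carry the bound [k <= n]. *)
Definition space f (k : nat) : {vspace V} := sval f (inord k).

Lemma space_mono f k l : (k <= l <= n)%N -> (space f k <= space f l)%VS.
Proof.
move=> /andP[kl ln]; have /and3P[_ _ /forallP/(_ (inord k))/forallP/(_ (inord l))] := valP f.
by rewrite !inordK ?ltnS // ?kl //; apply: leq_trans ln.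
Qed.

Lemma space0 f : space f 0 = 0%VS.
Proof.
have /and3P[/eqP <- _ _] := valP f; rewrite /space; congr (sval f _).
by apply: val_inj; rewrite /= inordK.
Qed.

Lemma space_full f : space f n = fullv.
Proof.
have /and3P[_ /eqP <- _] := valP f; rewrite /space; congr (sval f _).
by apply: val_inj; rewrite /= inordK.
Qed.

Lemma flag_eq f f' : (forall k, (k <= n)%N -> space f k = space f' k) -> f = f'.
Proof.
move=> H; apply: val_inj; apply/ffunP => i.
by have := H i; rewrite /space -ltnS ltn_ord inord_val; apply.
Qed.

(** * Labelled index sets *)

Section Labels.
Variables (I : finType) (b : I -> V).
Implicit Types (r s t : I -> 'I_n) (K : {set I}).

Definition antichain r s K := forall x y, x \in K -> y \in K -> x != y ->
  (((r x < r y) && (s y < s x)) || ((r y < r x) && (s x < s y)))%N.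

(** A finite set [I] with a row and a column for each label stands for [bidx X], and [K] marks the
    summands of the vector. Relabelling then changes the matrix without any transport between
    dependent index types. *)
Definition labelled r s K X :=
  [/\ forall i j, entry X i j = #|[pred x | (r x == i) && (s x == j)]|,
      decor X = [set (r x, s x) | x in K] & antichain r s K].

Definition flag_chart r f :=
  forall k, (k <= n)%N -> space f k = bspan b [pred x | r x < k]%N.

Definition chart r s K f f' w :=
  [/\ basis_of fullv [seq b x | x : I], flag_chart r f, flag_chart s f'
    & w = \sum_(x in K) b x].

Lemma flag_chart_exists r : basis_of fullv [seq b x | x : I] ->
  exists f, flag_chart r f.
Proof.
move=> bb; pose g := [ffun k : 'I_n.+1 => bspan b [pred x | r x < k]%N].
have gP : is_flag g.
  apply/and3P; split.
  - by rewrite ffunE -(bspan0 bb); apply/eqP/(eq_bspan bb) => x.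
  - by rewrite ffunE -(bspanT bb); apply/eqP/(eq_bspan bb) => x /=; rewrite ltn_ord.
  apply/forallP => i; apply/forallP => j; apply/implyP => ij; rewrite !ffunE.
  by apply: (bspan_sub bb) => x /= xi; apply: leq_trans ij.
exists (Sub g gP) => k kn; rewrite /space /= ffunE.
by apply: (eq_bspan bb) => x /=; rewrite inordK.
Qed.

(** This produces the factors of a product from a relabelling. No position holds more than
    [#|I| = d] labels, so [inord] loses nothing. *)
Lemma labelled_exists r s K : #|I| = d -> antichain r s K ->
  exists X, labelled r s K X.
Proof.
move=> cI aK.
pose A : 'M['I_d.+1]_n :=
  \matrix_(i, j) inord #|[pred x | (r x == i) && (s x == j)]|.
have AE i j : A i j = #|[pred x | (r x == i) && (s x == j)]| :> nat.
  by rewrite mxE inordK // ltnS -cI max_card.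
pose D := [set (r x, s x) | x in K].
have dP : decorated (A, D).
  apply/and3P; split=> /=.
  - apply/eqP; rewrite -[RHS]cI -sum1_card (partition_big r xpredT) //=; apply: eq_bigr => i _.
    rewrite (partition_big s xpredT) //=; apply: eq_bigr => j _.
    by rewrite AE -sum1_card.
  - apply/forall_inP => p /imsetP[x xK ->]; rewrite AE.
    by apply/card_gt0P; exists x; rewrite !inE !eqxx.
  - apply/forall_inP => p /imsetP[x xK ->]; apply/forall_inP => q /imsetP[y yK ->] /=.
    apply/implyP => xy; apply: aK => //; by apply: contra xy => /eqP ->.
by exists (Sub (A, D) dP); split.
Qed.

End Labels.

Definition rowl X (x : bidx X) : 'I_n := (tag x).1.
Definition coll X (x : bidx X) : 'I_n := (tag x).2.
Definition firsts X : {set bidx X} :=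
  [set x : bidx X | (tag x \in decor X) && (tagged x == 0%N :> nat)].

Lemma decor_antichain X p q : p \in decor X -> q \in decor X -> p != q ->
  (((p.1 < q.1) && (q.2 < p.2)) || ((q.1 < p.1) && (p.2 < q.2)))%N.
Proof.
have /and3P[_ _ /forall_inP H] := valP X.
by move=> pX qX; move: (H p pX) => /forall_inP/(_ q qX)/implyP.
Qed.

Lemma decor_entry X p : p \in decor X -> (0 < entry X p.1 p.2)%N.
Proof. by have /and3P[_ /forall_inP H _] := valP X; apply: H. Qed.

Lemma labelled_self X : labelled (@rowl X) (@coll X) (firsts X) X.
Proof.
split=> [i j||].
- pose h (y : 'I_(entry X i j)) : bidx X :=
    Tagged (fun p : 'I_n * 'I_n => 'I_(entry X p.1 p.2)) (y : 'I_(entry X (i, j).1 (i, j).2)).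
  have hI : injective h.
    move=> y z e; apply: val_inj.
    by have := congr1 (fun u : bidx X => nat_of_ord (tagged u)) e.
  rewrite -[LHS]card_ord -(card_image hI); apply: eq_card => x.
  rewrite !inE; apply/imageP/idP => [[y _ ->]|/andP[/eqP ri /eqP sj]].
    by rewrite /rowl /coll /= !eqxx.
  case: x ri sj => [[k l] u]; rewrite /rowl /coll /= => ki lj.
  by subst i j; exists u.
- apply/setP => p; apply/idP/imsetP => [pX|[x]]; last first.
    by rewrite inE => /andP[xX _] ->; rewrite /rowl /coll -surjective_pairing.
  exists (Tagged (fun p : 'I_n * 'I_n => 'I_(entry X p.1 p.2)) (Ordinal (decor_entry pX))).
    by rewrite inE /= pX.
  by case: (p) pX => ? ? ?.
- move=> [p u] [q w]; rewrite !inE /= => /andP[pX /eqP u0] /andP[qX /eqP w0] ne.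
  apply: (decor_antichain pX qX); apply: contraNneq ne => epq; subst q.
  by apply/eqP; congr existT; apply: val_inj; exact: etrans u0 (esym w0).
Qed.

Lemma card_bidx X : #|bidx X| = d.
Proof.
have [e _ _] := labelled_self X; have /and3P[/eqP eX _ _] := valP X.
rewrite -[RHS]eX -sum1_card (partition_big (@rowl X) xpredT) //=; apply: eq_bigr => i _.
rewrite (partition_big (@coll X) xpredT) //=; apply: eq_bigr => j _.
by rewrite -[RHS]/(entry X i j) e -sum1_card.
Qed.

Lemma orbit_chart X f f' w : in_orbit X f f' w ->
  exists b : bidx X -> V, chart b (@rowl X) (@coll X) (firsts X) f f' w.
Proof.
move=> /existsP[b /and4P[bb /forallP Hf /forallP Hf' /eqP ->]]; exists b; split=> //.
- by move=> k kn; rewrite /space (eqP (Hf _)); apply: (eq_bspan bb) => x /=; rewrite inordK.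
- by move=> k kn; rewrite /space (eqP (Hf' _)); apply: (eq_bspan bb) => x /=; rewrite inordK.
- by apply: eq_bigl => x; rewrite inE.
Qed.

Section ChartOrbit.
Variables (I : finType) (b : I -> V) (r s : I -> 'I_n) (K : {set I}) (X : Xi n d).
Hypotheses (cI : #|I| = d) (lX : labelled r s K X).

(** The labels of a position are listed with those in [K] first. By the antichain condition there is
    at most one of these, and it receives the index 0 that [adapted] prescribes for the summands of
    the vector. *)
Let fib (p : 'I_n * 'I_n) : seq I :=
  enum [pred x in K | (r x == p.1) && (s x == p.2)] ++
  enum [pred x | (x \notin K) && ((r x == p.1) && (s x == p.2))].

Let mem_fib x : x \in fib (r x, s x).
Proof. by rewrite mem_cat !mem_enum !inE !eqxx; case: (x \in K). Qed.

Let size_fib p : size (fib p) = entry X p.1 p.2.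
Proof.
have [-> _ _] := lX; rewrite size_cat -!cardE -[RHS](cardID (mem K)); congr (_ + _)%N.
by apply: eq_card => x; rewrite !inE andbC.
Qed.

Let index_fib x : (index x (fib (r x, s x)) < entry X (r x, s x).1 (r x, s x).2)%N.
Proof. by rewrite -size_fib index_mem mem_fib. Qed.

Let h x : bidx X :=
  Tagged (fun p : 'I_n * 'I_n => 'I_(entry X p.1 p.2)) (Ordinal (index_fib x)).

Let h_inj : injective h.
Proof.
move=> x y e; have e1 := congr1 (fun u : bidx X => tag u) e.
have := congr1 (fun u : bidx X => nat_of_ord (tagged u)) e.
rewrite /= in e1 *; rewrite e1 => e2.
by rewrite -(nth_index x (mem_fib x)) [X in fib X]e1 e2 nth_index ?mem_fib.
Qed.

Let h_first x : (tag (h x) \in decor X) && (tagged (h x) == 0%N :> nat) = (x \in K).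
Proof.
have [_ eD aK] := lX; rewrite /= eD; apply/andP/idP => [[/imsetP[y yK [ry sy]] /eqP i0]|xK].
  (* The label [y] shows that the part of the list inside [K] is nonempty, so the element of index
     0, which is [x], lies in [K]. *)
  have := nth_index x (mem_fib x); rewrite i0 nth_cat -cardE.
  have yF : y \in [pred x0 in K | (r x0 == r x) && (s x0 == s x)].
    by rewrite !inE yK ry sy !eqxx.
  have -> : (0 < #|[pred x0 in K | (r x0 == r x) && (s x0 == s x)]|)%N.
    by apply/card_gt0P; exists y.
  move=> e; have : x \in enum [pred x0 in K | (r x0 == r x) && (s x0 == s x)].
    rewrite -{1}e mem_nth // -cardE; by apply/card_gt0P; exists y.
  by rewrite mem_enum !inE => /andP[].
split; first by apply/imsetP; exists x.
have -> : fib (r x, s x) = x :: behead (fib (r x, s x)).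
  rewrite /fib /= (_ : enum _ = [:: x]) // -[RHS](enum1 x); apply: eq_enum => y.
  rewrite !inE; apply/idP/eqP => [/andP[yK /andP[/eqP ry /eqP sy]]|->]; last by rewrite xK !eqxx.
  apply: contraTeq isT => ne; move: (aK y x yK xK ne); rewrite ry sy !ltnn //.
by rewrite /= eqxx.
Qed.

(** The enumeration of each position gives a bijection [h] from [I] to [bidx X], and its inverse
    transports the basis. *)
Lemma chart_orbit f f' w : chart b r s K f f' w -> in_orbit X f f' w.
Proof.
move=> [bb cf cf' ->].
have hB : bijective h by apply: inj_card_bij; rewrite // cI card_bidx.
have [g hK gK] := hB.
have rg y : r (g y) = (tag y).1 by rewrite -[in RHS](gK y).
have sg y : s (g y) = (tag y).2 by rewrite -[in RHS](gK y).
pose b' := [ffun y => b (g y)].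
have spE (Q : pred I) (Q' : pred (bidx X)) : (forall y, Q' y = Q (g y)) ->
    bspan b Q = <<[seq b' y | y : bidx X in Q']>>%VS.
  move=> e; apply: eq_span => u; apply/mapP/mapP => [[x]|[y]]; rewrite mem_enum => xQ ->.
    by exists (h x); rewrite ?ffunE ?hK // mem_enum unfold_in e hK.
  by exists (g y); rewrite ?ffunE // mem_enum unfold_in -e.
apply/existsP; exists b'; apply/and4P; split.
- have -> : [seq b' y | y : bidx X] = [seq b x | x <- map g (enum (bidx X))].
    by rewrite -map_comp; apply: eq_map => y; rewrite ffunE.
  rewrite (@perm_basis _ _ _ [seq b x | x : I]) //; apply: perm_map.
  apply: uniq_perm; [by rewrite (map_inj_uniq (can_inj gK)) enum_uniq | exact: enum_uniq |].
  by move=> x; rewrite mem_enum inE; apply/mapP; exists (h x); rewrite ?mem_enum ?hK.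
- apply/forallP => i; apply/eqP.
  have := cf i; rewrite -ltnS ltn_ord /space inord_val => ->//.
  by apply: spE => y /=; rewrite rg.
- apply/forallP => i; apply/eqP.
  have := cf' i; rewrite -ltnS ltn_ord /space inord_val => ->//.
  by apply: spE => y /=; rewrite sg.
- rewrite (reindex h) /=; last exact: onW_bij.
  by apply/eqP/eq_big => [x|x _]; rewrite ?h_first ?ffunE ?hK.
Qed.

End ChartOrbit.

End Charts.

(** * Invariants of an orbit *)

Lemma card_sum_bool (I : finType) (A : pred I) : #|A| = (\sum_x A x)%N.
Proof. by rewrite -sum1_card big_mkcond; apply: eq_bigr => x _; rewrite unfold_in; case: (A x). Qed.

Section Invariants.
Variables (n d : nat).
Implicit Types (X Y B : Xi n d) (D : {set 'I_n * 'I_n}).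

Lemma Xi_ext X Y : entry X =2 entry Y -> decor X = decor Y -> X = Y.
Proof.
move=> eE eD; apply: val_inj; apply: injective_projections; last exact: eD.
by apply/matrixP => i j; apply: val_inj; exact: eE.
Qed.

Definition dominated (D D' : {set 'I_n * 'I_n}) : bool :=
  [forall p in D, [exists q in D', (p.1 <= q.1)%N && (p.2 <= q.2)%N]].

Lemma dominatedP D D' :
  reflect (forall p, p \in D -> exists q, [/\ q \in D', (p.1 <= q.1)%N & (p.2 <= q.2)%N])
          (dominated D D').
Proof.
apply: (iffP forall_inP) => H p /H; first by move=> /existsP[q /and3P[]]; exists q.
by move=> [q [*]]; apply/existsP; exists q; apply/and3P.
Qed.

Lemma dominated_refl D : dominated D D.
Proof. by apply/dominatedP => p; exists p. Qed.

Lemma decor_incomparable X p q : p \in decor X -> q \in decor X ->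
  (p.1 <= q.1)%N -> (p.2 <= q.2)%N -> p = q.
Proof.
by move=> pX qX le1 le2; apply/eqP/contraT => ne; have := decor_antichain pX qX ne; lia.
Qed.

(** An antichain consists of the maximal elements of the order ideal that it generates, hence is
    determined by this ideal. *)
Lemma dominated_decor_eq X Y :
  dominated (decor X) (decor Y) -> dominated (decor Y) (decor X) -> decor X = decor Y.
Proof.
suff sub X' Y' : dominated (decor X') (decor Y') -> dominated (decor Y') (decor X') ->
    decor X' \subset decor Y'.
  by move=> XY YX; apply/eqP; rewrite eqEsubset !sub.
move=> /dominatedP XY /dominatedP YX; apply/subsetP => p pX.
have [q [qY p1 p2]] := XY p pX; have [u [uX q1 q2]] := YX q qY.
have pu : p = u by apply: (decor_incomparable pX uX); lia.
suff -> : p = q by [].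
by subst u; apply: injective_projections; apply/ord_inj/eqP; rewrite eqn_leq ?p1 ?q1 ?p2 ?q2.
Qed.

(** On an orbit this is the dimension of the intersection of the k-th space of the first flag with
    the l-th space of the second. *)
Definition rk X k l := #|[pred x : bidx X | (rowl x < k)%N && (coll x < l)%N]|.

(** An entry is the second difference of [rk]; the terms are distributed so as to avoid truncated
    subtraction. *)
Lemma entry_rk X (i j : 'I_n) :
  (entry X i j + rk X i j.+1 + rk X i.+1 j = rk X i.+1 j.+1 + rk X i j)%N.
Proof.
have [-> _ _] := labelled_self X; rewrite /rk !card_sum_bool.
rewrite -!big_split; apply: eq_bigr => x _; rewrite /= -!val_eqE /=.
lia.
Qed.

Lemma rk_sum X k l :
  rk X k l = (\sum_(p : 'I_n * 'I_n | (p.1 < k) && (p.2 < l)) entry X p.1 p.2)%N.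
Proof.
rewrite /rk -sum1_card (partition_big (fun x : bidx X => (rowl x, coll x))
  (fun p => (p.1 < k) && (p.2 < l))%N) //=.
apply: eq_bigr => -[a c] /= /andP[ak cl]; have [-> _ _] := labelled_self X.
rewrite sum1_card; apply: eq_card => x; rewrite unfold_in /= !inE xpair_eqE.
by case: eqP => [->|]; case: eqP => [->|]; rewrite ?andbF ?ak ?cl.
Qed.

(** Additive form of Y = X - E_p + E_q, which avoids truncated subtraction. *)
Definition moved X Y (p q : 'I_n * 'I_n) :=
  forall i j, (entry Y i j + ((i, j) == p) = entry X i j + ((i, j) == q))%N.

Lemma rk_moved X Y p q k l : moved X Y p q ->
  (rk Y k l + ((p.1 < k) && (p.2 < l)) = rk X k l + ((q.1 < k) && (q.2 < l)))%N.
Proof.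
have cell (u : 'I_n * 'I_n) : (\sum_(c : 'I_n * 'I_n | (c.1 < k) && (c.2 < l)) (c == u) =
    (u.1 < k) && (u.2 < l))%N.
  case H: ((u.1 < k) && (u.2 < l))%N.
    by rewrite (bigD1 u) //= eqxx big1 // => c /andP[_ /negPf ->].
  by rewrite big1 // => c; case: eqP => // ->; rewrite H.
move=> mv; rewrite !rk_sum -!cell -!big_split; apply: eq_bigr => -[a c] _.
exact: mv.
Qed.

(** The diagonal is left free, so that all matrices summed in one generator satisfy the same
    condition. *)
Definition offdiag X (E : {set 'I_n * 'I_n}) :=
  forall i j, i != j -> entry X i j = ((i, j) \in E).

Lemma offdiag_label X E (x : bidx X) :
  offdiag X E -> rowl x != coll x -> (rowl x, coll x) \in E.
Proof.
move=> oX ne; have := oX _ _ ne; case: (_ \in E) => // e.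
have [eX _ _] := labelled_self X; move: e; rewrite eX => /card0_eq/(_ x).
by rewrite !inE !eqxx.
Qed.

Fact tr_subproof X :
  decorated (\matrix_(i, j) (val X).1 j i, [set (p.2, p.1) | p in (val X).2]).
Proof.
have /and3P[/eqP s p a] := valP X; apply/and3P; split=> /=.
- rewrite -[X in _ == X]s exchange_big /=; apply/eqP/eq_bigr => i _; apply: eq_bigr => j _.
  by rewrite mxE.
- by apply/forall_inP => q /imsetP[u uX ->]; rewrite mxE (forall_inP p).
apply/forall_inP => q /imsetP[u uX ->]; apply/forall_inP => q' /imsetP[v vX ->] /=.
apply/implyP => ne; have nuv : u != v by apply: contra ne => /eqP->.
by rewrite orbC andbC [X in _ || X]andbC; exact: decor_antichain uX vX nuv.
Qed.

(** Transposition corresponds to exchanging the two flags of a triple. It reverses products and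
    exchanges the two sides of the diagonal. *)
Definition tr X : Xi n d := Sub (_, _) (tr_subproof X).

Lemma entry_tr X i j : entry (tr X) i j = entry X j i.
Proof. by rewrite /entry /= mxE. Qed.

Lemma decor_tr X : decor (tr X) = [set (p.2, p.1) | p in decor X].
Proof. by []. Qed.

Lemma trK : involutive tr.
Proof.
move=> X; apply: Xi_ext => [i j|]; rewrite ?entry_tr // !decor_tr -imset_comp.
by rewrite -[RHS]imset_id; apply: eq_imset => -[].
Qed.

Lemma mem_decor_tr X p : (p \in decor (tr X)) = ((p.2, p.1) \in decor X).
Proof.
rewrite decor_tr; apply/imsetP/idP => [[q qX ->]|pX] /=; first by case: q qX.
by exists (p.2, p.1) => //; case: p pX.
Qed.

(** * Recovering the matrix and the decoration from a triple *)

Section Orbit.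
Variables (F : finFieldType).
Implicit Types (f : flag F n d) (w m : 'rV[F]_d).

Lemma orbit_tr X f f' w : in_orbit X f f' w -> in_orbit (tr X) f' f w.
Proof.
move=> /orbit_chart[b [bb cf cf' ew]]; have [eX dX aX] := labelled_self X.
apply: (@chart_orbit _ _ _ _ b (@coll _ _ X) (@rowl _ _ X) (firsts X)) => //.
  exact: card_bidx.
split=> [i j||x y xK yK ne].
- by rewrite entry_tr eX; apply: eq_card => x; rewrite !inE andbC.
- by rewrite decor_tr dX -imset_comp; apply: eq_imset.
- by have := aX x y xK yK ne; lia.
Qed.

Lemma orbit_rk X f f' w k l : in_orbit X f f' w -> (k <= n)%N -> (l <= n)%N ->
  \dim (space f k :&: space f' l) = rk X k l.
Proof.
move=> /orbit_chart[b [bb cf cf' _]] kn ln.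
by rewrite cf // cf' // (bspanI bb) (dim_bspan bb).
Qed.

Lemma orbit_entry X Y f f' w w' : in_orbit X f f' w -> in_orbit Y f f' w' ->
  entry X =2 entry Y.
Proof.
move=> oX oY i j; have eX := entry_rk X i j; have eY := entry_rk Y i j.
have e k l : (k <= n)%N -> (l <= n)%N -> rk X k l = rk Y k l.
  by move=> kn ln; rewrite -(orbit_rk oX) // -(orbit_rk oY).
have := (e i j, e i j.+1, e i.+1 j, e i.+1 j.+1).
have := ltn_ord i; have := ltn_ord j => jn iN [[[e1 e2] e3] e4].
move: eX eY; rewrite e1 ?e2 ?e3 ?e4 ?(ltnW jn) ?(ltnW iN) // => <- /eqP.
by rewrite -!addnA !eqn_add2r => /eqP.
Qed.

(** The vector is the sum of the first basis vectors at the decorated positions, so membership tests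
    exactly these positions. *)
Lemma chart_mem X (b : bidx X -> 'rV[F]_d) f f' w (T : pred ('I_n * 'I_n)) :
  chart b (@rowl _ _ X) (@coll _ _ X) (firsts X) f f' w ->
  (w \in bspan b [pred x | T (rowl x, coll x)]) = [forall p in decor X, T p].
Proof.
move=> [bb _ _ ->]; have [_ -> _] := labelled_self X; rewrite (mem_bspan_sum bb).
apply/forall_inP/forall_inP => [H p /imsetP[x xK ->]|H x xK]; first exact: H.
by apply: (H (_, _)); apply/imsetP; exists x.
Qed.

Lemma mem_rowcol X f f' w k l : in_orbit X f f' w -> (k <= n)%N -> (l <= n)%N ->
  (w \in space f k + space f' l)%VS =
    [forall p in decor X, (p.1 < k)%N || (p.2 < l)%N].
Proof.
move=> /orbit_chart[b ch] kn ln; have [bb cf cf' _] := ch.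
by rewrite cf // cf' // (bspanD bb) -(chart_mem _ ch).
Qed.

Lemma mem_row X f f' w k : in_orbit X f f' w -> (k <= n)%N ->
  (w \in space f k) = [forall p in decor X, (p.1 < k)%N].
Proof.
move=> oX kn; have := mem_rowcol oX kn (leq0n n); rewrite space0 addv0 => ->.
by apply: eq_forallb => p; rewrite orbF.
Qed.

Lemma mem_col X f f' w l : in_orbit X f f' w -> (l <= n)%N ->
  (w \in space f' l) = [forall p in decor X, (p.2 < l)%N].
Proof.
by move=> oX ln; have := mem_rowcol oX (leq0n n) ln; rewrite space0 add0v => ->.
Qed.

(** Defined by the flags alone, this is the span of the basis vectors at positions in the order
    ideal generated by [D], for every basis adapted to both flags. *)
Definition ideal_space f f' (D : {set 'I_n * 'I_n}) : {vspace 'rV[F]_d} :=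
  (\sum_(q in D) (space f q.1.+1 :&: space f' q.2.+1))%VS.

Lemma ideal_chart (I : finType) (b : I -> 'rV[F]_d) (r s : I -> 'I_n) f f' D :
  basis_of fullv [seq b x | x : I] -> flag_chart b r f -> flag_chart b s f' ->
  ideal_space f f' D =
    bspan b [pred x | [exists q in D, (r x <= q.1) && (s x <= q.2)]%N].
Proof.
move=> bb cf cf'; rewrite -(bspan_sum bb (fun q => q \in D)
  (fun q => [pred x | (r x <= q.1) && (s x <= q.2)]%N)).
by apply: eq_bigr => q _; rewrite cf // cf' // (bspanI bb).
Qed.

Lemma mem_ideal X f f' w D : in_orbit X f f' w ->
  (w \in ideal_space f f' D) = dominated (decor X) D.
Proof.
move=> /orbit_chart[b ch]; have [bb cf cf' _] := ch; rewrite (ideal_chart D bb cf cf').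
exact: (chart_mem (fun p => [exists q in D, (p.1 <= q.1) && (p.2 <= q.2)]%N) ch).
Qed.

(** The matrix is given by dimensions of intersections. Testing the vector against the ideal spaces
    of both decorations shows that each dominates the other. *)
Lemma orbit_inj X Y f f' w : in_orbit X f f' w -> in_orbit Y f f' w -> X = Y.
Proof.
move=> oX oY; apply: Xi_ext; first exact: orbit_entry oX oY.
apply: dominated_decor_eq.
  by rewrite -(mem_ideal _ oX) (mem_ideal _ oY) dominated_refl.
by rewrite -(mem_ideal _ oY) (mem_ideal _ oX) dominated_refl.
Qed.

Lemma orbit_diag X f f' w : offdiag X set0 -> in_orbit X f f' w -> f = f'.
Proof.
move=> oX /orbit_chart[b [bb cf cf' _]]; apply: flag_eq => k kn.
rewrite cf // cf' //; apply: (eq_bspan bb) => x /=.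
have [->//|/(offdiag_label oX)] := eqVneq (rowl x) (coll x).
by rewrite inE.
Qed.

Definition hyperplane_at (h : 'I_n) f f'' :=
  [/\ forall k, (k <= n)%N -> k != h.+1 -> space f k = space f'' k,
      (space f'' h.+1 <= space f h.+1)%VS
    & \dim (space f h.+1) = (\dim (space f'' h.+1)).+1].

(** The single basis vector at (h, h+1) lies in the space h+1 of [f] but not in that of [f'']; all
    other basis vectors sit on the diagonal. *)
Lemma orbit_up B (h h' : 'I_n) f f'' w : h' = h.+1 :> nat ->
  offdiag B [set (h, h')] -> in_orbit B f f'' w -> hyperplane_at h f f''.
Proof.
move=> eh oB /orbit_chart[b [bb cf cf' _]].
have lab (x : bidx B) : (rowl x == coll x) || ((rowl x == h) && (coll x == h')).
  have [//|/(offdiag_label oB)] := eqVneq (rowl x) (coll x).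
  by rewrite inE xpair_eqE.
split=> [k kn kh||].
- rewrite cf // cf' //; apply: (eq_bspan bb) => x /=.
  by case/orP: (lab x) => [/eqP->//|/andP[/eqP-> /eqP->]]; lia.
- rewrite cf // cf' //; apply: (bspan_sub bb) => x /=.
  by case/orP: (lab x) => [/eqP->//|/andP[/eqP-> /eqP->]]; lia.
rewrite cf // cf' // !(dim_bspan bb).
have : entry B h h' = 1%N by rewrite oB ?inE ?eqxx // -val_eqE /= eh; lia.
have [-> _ _] := labelled_self B => e1; rewrite -[RHS]addn1 -[X in _ = (_ + X)%N]e1.
rewrite !card_sum_bool -big_split; apply: eq_bigr => x _ /=.
case/orP: (lab x) => [/eqP->|/andP[/eqP-> /eqP->]].
  by rewrite -!val_eqE /= eh; lia.
by rewrite !eqxx /= eh ltnS leqnn ltnn.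
Qed.

(** Both intersections on the left lie in [U :&: W'], and they meet inside [U' :&: W]. *)
Lemma dimv_supermodular (U U' W W' : {vspace 'rV[F]_d}) : (U' <= U)%VS -> (W <= W')%VS ->
  (\dim (U :&: W) + \dim (U' :&: W') <= \dim (U' :&: W) + \dim (U :&: W'))%N.
Proof.
move=> sU sW; rewrite -dimv_sum_cap addnC leq_add //.
  apply: dimvS; rewrite subv_cap; apply/andP; split.
    exact: subv_trans (capvSr _ _) (capvSl _ _).
  exact: subv_trans (capvSl _ _) (capvSr _ _).
by apply: dimvS; rewrite subv_add capvS //= capvS.
Qed.

(** Only the ranks with first index h+1 change. Their difference is nondecreasing in the column
    index and grows from 0 to 1, so it jumps at a single column [l]. *)
Lemma hyperplane_moved X Y (h h' : 'I_n) f f' f'' w w' : h' = h.+1 :> nat ->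
  hyperplane_at h f f'' -> in_orbit X f'' f' w -> in_orbit Y f f' w' ->
  exists l, moved X Y (h', l) (h, l).
Proof.
move=> eh [eV sV dV] oX oY.
have rkE k l : (k <= n)%N -> (l <= n)%N -> k != h.+1 -> rk X k l = rk Y k l.
  by move=> kn ln kh; rewrite -(orbit_rk oX) // -(orbit_rk oY) // eV.
have mono k l : (k <= l <= n)%N ->
    (rk Y h.+1 k + rk X h.+1 l <= rk X h.+1 k + rk Y h.+1 l)%N.
  move=> /andP[kl ln]; have kn := leq_trans kl ln.
  rewrite -!(orbit_rk oX) // -!(orbit_rk oY) //.
  by apply: dimv_supermodular => //; apply: space_mono; rewrite kl.
have rkn : rk Y h.+1 n = (rk X h.+1 n).+1.
  by rewrite -!(orbit_rk oX) // -!(orbit_rk oY) // space_full !capvf.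
have rk0 : rk Y h.+1 0 = rk X h.+1 0.
  by rewrite -!(orbit_rk oX) // -!(orbit_rk oY) // space0 !capv0.
have [l rl rlS] : exists2 l : 'I_n, rk Y h.+1 l = rk X h.+1 l &
    rk Y h.+1 l.+1 = (rk X h.+1 l.+1).+1.
  (* The least index at which the ranks differ is positive, and its predecessor is the column of the
     jump. *)
  have ex : exists l, (l <= n)%N && (rk X h.+1 l < rk Y h.+1 l)%N.
    by exists n; rewrite leqnn rkn /=.
  case: (ex_minnP ex) => -[|l] /andP[ln lt] min; first by rewrite rk0 ltnn in lt.
  exists (Ordinal ln) => /=.
    have m0 := mono 0%N l; have := min l; lia.
  have := mono l.+1 n; lia.
exists l => i j.
have eX := entry_rk X i j; have eY := entry_rk Y i j.
have st k : (k <= n)%N -> (rk Y h.+1 k = rk X h.+1 k + (l < k)%N)%N.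
  move=> kn; case: ltnP => lk.
    have := mono l.+1 k; have := mono k n; lia.
  have := mono 0%N k; have := mono k l; have := ltn_ord l; lia.
have jn := ltn_ord j; have jn' := ltnW jn.
have iN : (i <= n)%N by apply: ltnW.
rewrite !xpair_eqE -!val_eqE /= eh.
have [ih|ih] := eqVneq (i : nat) h.
  rewrite ih in eX eY *; move: eY; rewrite !st // => eY.
  have r1 := rkE h j.+1; have r2 := rkE h j; have hn := ltn_ord h; lia.
have [ih'|ih'] := eqVneq (i : nat) h.+1.
  rewrite ih' in eX eY *; move: eY; rewrite !st // => eY.
  have r1 := rkE h.+2 j.+1; have r2 := rkE h.+2 j; have hn := ltn_ord h'; lia.
have r1 := rkE i j; have r2 := rkE i j.+1; have r3 := rkE i.+1 j; have r4 := rkE i.+1 j.+1.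
have := ltn_ord i; have := ltn_ord j; lia.
Qed.

End Orbit.
End Invariants.

(** * Configurations *)

Section Configurations.
Variables (n d : nat).
Implicit Types (X Y Z B : Xi n d) (D : {set 'I_n * 'I_n}).

(* This is equivalent to e_Z having a nonzero coefficient in e_X e_Y over Q(v). *)
Definition config X Y Z := exists (F : finFieldType) (f f' f'' : flag F n d) (w m : 'rV[F]_d),
  [/\ in_orbit Z f f' w, in_orbit X f f'' m & in_orbit Y f'' f' (w - m)].

Lemma config_tr X Y Z : config X Y Z -> config (tr Y) (tr X) (tr Z).
Proof.
move=> [F [f [f' [f'' [w [m [oZ oX oY]]]]]]].
exists F, f', f, f'', w, (w - m); split; try exact: orbit_tr.
by rewrite subKr; exact: orbit_tr.
Qed.

Lemma orbit_decor0 (F : finFieldType) (f f' : flag F n d) X w :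
  decor X = set0 -> in_orbit X f f' w -> w = 0.
Proof.
move=> dX oX; apply/eqP; rewrite -memv0 -(space0 f) (mem_row oX) //.
by rewrite dX; apply/forall_inP => p; rewrite inE.
Qed.

Lemma entry_label X i j : (0 < entry X i j)%N -> exists x : bidx X, rowl x = i /\ coll x = j.
Proof.
have [-> _ _] := labelled_self X => /card_gt0P[x]; rewrite !inE => /andP[/eqP ? /eqP ?].
by exists x.
Qed.

Lemma decor_offdiag X E p : offdiag X E -> p \in decor X -> p.1 = p.2 \/ p \in E.
Proof.
move=> oX pX; have := decor_entry pX; have [|ne] := eqVneq p.1 p.2; first by left.
by rewrite oX // -surjective_pairing; case: (p \in E) => // _; right.
Qed.

Lemma decor_single X p : p \in decor X ->
  (forall q, q \in decor X -> ((q.1 <= p.1) && (q.2 <= p.2) || (p.1 <= q.1) && (p.2 <= q.2))%N) ->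
  decor X = [set p].
Proof.
move=> pX H; apply/setP => q; rewrite inE; apply/idP/eqP => [qX|->//].
have [/andP[a1 a2]|/andP[a1 a2]] := orP (H q qX); last apply: esym.
  exact: (decor_incomparable qX pX).
exact: (decor_incomparable pX qX).
Qed.

Lemma moved_gt0 X Y p q : moved X Y p q -> p != q -> (0 < entry X p.1 p.2)%N.
Proof.
by move=> /(_ p.1 p.2); rewrite -surjective_pairing eqxx => + /negPf pq; rewrite pq; lia.
Qed.

Lemma moved_gt0r X Y p q : moved X Y p q -> p != q -> (0 < entry Y q.1 q.2)%N.
Proof.
by move=> /(_ q.1 q.2); rewrite -surjective_pairing eqxx eq_sym => + /negPf pq; rewrite pq; lia.
Qed.

(** Only triples reached by a product of two orbits are required to lie in an orbit;
    [covering_generic] obtains this from the structure constants. *)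
Definition covering := forall (F : finFieldType) (f f' f'' : flag F n d) (w m : 'rV[F]_d) X Y,
  in_orbit X f f'' m -> in_orbit Y f'' f' (w - m) -> exists Z, in_orbit Z f f' w.

(** * Configurations from several labellings of one basis *)

Section Relabel.
Variable I : finType.
Implicit Types (r s t : I -> 'I_n) (K : {set I}).

Lemma antichain0 r s : antichain r s set0.
Proof. by move=> x y; rewrite inE. Qed.

Lemma antichain1 r s x : antichain r s [set x].
Proof. by move=> y z; rewrite !inE => /eqP -> /eqP ->; rewrite eqxx. Qed.

Lemma labelled_offdiag r s K (J : {set I}) X : labelled r s K X ->
  {in J &, injective (fun x => (r x, s x))} -> (forall x, (x \in J) = (r x != s x)) ->
  offdiag X [set (r x, s x) | x in J].
Proof.
move=> [eX _ _] injJ JE i j ne; rewrite eX; case: imsetP => [[x xJ [-> ->]]|H].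
  apply/eqP/card1P; exists x => y; rewrite !inE; apply/andP/eqP => [[/eqP ry /eqP sy]|->//].
  by apply: injJ; rewrite ?JE ?ry ?sy -?JE.
apply: eq_card0 => y; rewrite !inE; apply/andP => -[/eqP ry /eqP sy].
by apply: H; exists y; rewrite ?JE ry sy.
Qed.

Lemma labelled_diag r K X : labelled r r K X -> offdiag X set0.
Proof.
move=> lX; rewrite -(imset0 (fun x => (r x, r x))).
by apply: (labelled_offdiag lX) => x; rewrite inE // eqxx.
Qed.

Lemma labelled_offdiag1 r s K X x : labelled r s K X -> r x != s x ->
  (forall y, y != x -> r y = s y) -> offdiag X [set (r x, s x)].
Proof.
move=> lX ne H; rewrite -(imset_set1 (fun x => (r x, s x))).
apply: (labelled_offdiag lX) => [y z|y]; first by rewrite !inE => /eqP -> /eqP ->.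
by rewrite inE; have [->|/H->] := eqVneq y x; rewrite ?ne ?eqxx.
Qed.

Lemma labelled_moved r s r' s' K K' X Y x : labelled r s K X -> labelled r' s' K' Y ->
  (forall y, y != x -> r' y = r y /\ s' y = s y) -> moved X Y (r x, s x) (r' x, s' x).
Proof.
move=> [eX _ _] [eY _ _] H i j; rewrite eX eY !card_sum_bool.
rewrite (bigD1 x) //= [in RHS](bigD1 x) //=.
rewrite (eq_bigr (fun y => ((r y == i) && (s y == j)) : nat)) => [|y /H[-> ->] //].
rewrite !xpair_eqE ![i == _]eq_sym ![j == _]eq_sym.
lia.
Qed.

Lemma label_basis (F : finFieldType) : #|I| = d ->
  exists b : I -> 'rV[F]_d, basis_of fullv [seq b x | x : I].
Proof.
move=> cI; pose bb := vbasis (@fullv F 'rV[F]_d).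
pose b (x : I) : 'rV[F]_d := bb`_(enum_rank x); exists b.
have -> : [seq b x | x : I] = bb.
  have sb : size bb = #|I| by rewrite size_tuple dimvf /dim /= mul1n.
  apply: (@eq_from_nth _ 0) => [|i]; rewrite size_map -cardE -?sb // => ib.
  have iI : (i < #|I|)%N by rewrite -sb.
  by rewrite (nth_codom _ b (Ordinal iI)) /b enum_valK.
exact: vbasisP.
Qed.

Lemma sum_setU (V : zmodType) (b : I -> V) K1 K2 : [disjoint K1 & K2] ->
  \sum_(x in K1 :|: K2) b x = \sum_(x in K1) b x + \sum_(x in K2) b x.
Proof.
by move=> dK; rewrite (eq_bigl [predU K1 & K2]) ?bigU // => x; rewrite !inE.
Qed.

(** One basis with three labellings gives three flags, and the disjoint sets [K1] and [K2] split the
    vector into its two summands. A configuration over a single field is enough, here ['F_2]. *)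
Lemma relabel_config r t s K1 K2 X Y Z : #|I| = d -> [disjoint K1 & K2] ->
  labelled r t K1 X -> labelled t s K2 Y -> labelled r s (K1 :|: K2) Z -> config X Y Z.
Proof.
move=> cI dK lX lY lZ; have [b b_basis] := label_basis 'F_2 cI.
have [f cf] := flag_chart_exists r b_basis.
have [f' cf'] := flag_chart_exists s b_basis.
have [f'' cf''] := flag_chart_exists t b_basis.
have orb r1 r2 K W g g' : flag_chart b r1 g -> flag_chart b r2 g' -> labelled r1 r2 K W ->
    in_orbit W g g' (\sum_(x in K) b x).
  by move=> cg cg' lW; apply: (chart_orbit (b := b) cI lW); split.
exists 'F_2, f, f', f'', (\sum_(x in K1 :|: K2) b x), (\sum_(x in K1) b x).
rewrite {2}sum_setU // addrAC subrr add0r.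
by split; [exact: orb cf cf' lZ|exact: orb cf cf'' lX|exact: orb cf'' cf' lY].
Qed.

(* The labels (r x, t x) for x in K1 :|: K2 need not form an antichain, so that
   the orbit X of the sum of the b x is known to exist only by covering. *)
Lemma relabel_config_covering r t s K1 K2 Y Z D : covering ->
  #|I| = d -> [disjoint K1 & K2] -> antichain r r K1 -> antichain r t K2 ->
  labelled t s set0 Y -> labelled r s (K1 :|: K2) Z ->
  (forall x, x \in K1 :|: K2 ->
     exists q, [/\ q \in D, (r x <= q.1)%N & (t x <= q.2)%N]) ->
  exists X, [/\ config X Y Z, dominated (decor X) D &
    forall i j, entry X i j = #|[pred x | (r x == i) && (t x == j)]|].
Proof.
move=> cov cI dK a1 a2 lY lZ HD; have [b b_basis] := label_basis 'F_2 cI.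
have [f cf] := flag_chart_exists r b_basis.
have [f' cf'] := flag_chart_exists s b_basis.
have [f'' cf''] := flag_chart_exists t b_basis.
have orb r1 r2 K W g g' : flag_chart b r1 g -> flag_chart b r2 g' -> labelled r1 r2 K W ->
    in_orbit W g g' (\sum_(x in K) b x).
  by move=> cg cg' lW; apply: (chart_orbit (b := b) cI lW); split.
(* [X1] has [f] itself as its second flag and carries the part [K1] of the vector, [X2] carries the
   rest; [covering] is applied to their product. *)
have [X1 l1] := labelled_exists cI a1; have [X2 l2] := labelled_exists cI a2.
have o1 := orb _ _ _ _ _ _ cf cf l1; have o2 := orb _ _ _ _ _ _ cf cf'' l2.
pose w := \sum_(x in K1 :|: K2) b x.
have o2' : in_orbit X2 f f'' (w - \sum_(x in K1) b x).
  by rewrite /w sum_setU // addrAC subrr add0r.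
have [X oX] := cov _ _ _ _ _ _ _ _ o1 o2'; exists X; split.
(* The whole vector goes to the left factor, as [Y] has no decoration. *)
- exists 'F_2, f, f', f'', w, w; split=> //; first exact: orb cf cf' lZ.
  by have := orb _ _ _ _ _ _ cf'' cf' lY; rewrite big_set0 subrr.
- rewrite -(mem_ideal _ oX) (ideal_chart D b_basis cf cf'') (mem_bspan_sum b_basis).
  apply/forall_inP => x /HD[q [*]]; apply/existsP; exists q; exact/and3P.
- by move=> i j; have [<- _ _] := l2; exact: (orbit_entry oX o2 i j).
Qed.

End Relabel.

(** These are the combinatorial properties of the predicate that e_X lies in [U], so that both
    inductions run without vectors over Q(v). The rule [gen_step] extracts the last unknown term of
    a product. *)
Record generated (P : pred (Xi n d)) : Prop := {
  gen_step : forall X Y Z, P X -> P Y -> config X Y Z ->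
    (forall Z1, config X Y Z1 -> Z1 != Z -> P Z1) -> P Z;
  gen_diag : forall X, decor X = set0 -> offdiag X set0 -> P X;
  gen_up : forall X (h h' : 'I_n), h' = h.+1 :> nat -> decor X = set0 ->
    offdiag X [set (h, h')] -> P X;
  gen_down : forall X (h h' : 'I_n), h' = h.+1 :> nat -> decor X = set0 ->
    offdiag X [set (h', h)] -> P X;
  gen_vector : forall X (o : 'I_n), o = 0%N :> nat -> decor X = [set (o, o)] ->
    offdiag X set0 -> P X }.

Lemma offdiag_tr X E : offdiag X E -> offdiag (tr X) [set (p.2, p.1) | p in E].
Proof.
move=> oX i j ne; rewrite entry_tr oX 1?eq_sym //; congr nat_of_bool.
apply/idP/imsetP => [H|[p pE [-> ->]]]; last by rewrite -surjective_pairing.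
by exists (j, i).
Qed.

Lemma offdiag_tr0 X : offdiag X set0 -> offdiag (tr X) set0.
Proof. by move=> /offdiag_tr; rewrite imset0. Qed.

Lemma offdiag_tr1 X p : offdiag X [set p] -> offdiag (tr X) [set (p.2, p.1)].
Proof. by move=> /offdiag_tr; rewrite imset_set1. Qed.

Lemma generated_tr P : generated P -> generated (fun X => P (tr X)).
Proof.
move=> gP; split.
- move=> X Y Z PX PY cZ H; apply: (gen_step gP PY PX (config_tr cZ)) => Z1 cZ1 ne.
  rewrite -[Z1]trK; apply: H; last by apply: contra ne => /eqP <-; rewrite trK.
  by rewrite -[X]trK -[Y]trK; apply: config_tr.
- by move=> X dX oX; apply: (gen_diag gP); [rewrite decor_tr dX imset0|exact: offdiag_tr0].
- move=> X h h' e dX oX; apply: (gen_down gP e); first by rewrite decor_tr dX imset0.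
  exact: (offdiag_tr1 oX).
- move=> X h h' e dX oX; apply: (gen_up gP e); first by rewrite decor_tr dX imset0.
  exact: (offdiag_tr1 oX).
move=> X o e dX oX; apply: (gen_vector gP e); last exact: offdiag_tr0.
by rewrite decor_tr dX imset_set1.
Qed.

End Configurations.

(** * Diagonal matrices with one decoration *)

Section DiagonalVectors.
Variables (n d : nat) (P : pred (Xi n d)).
Hypothesis gP : generated P.
Variables (i i' : 'I_n).
Hypothesis i'E : i' = i.+1 :> nat.
Hypothesis vec_le : forall Z (k : 'I_n), (k <= i)%N -> offdiag Z set0 ->
  decor Z = [set (k, k)] -> P Z.
Implicit Types X Y Z B : Xi n d.

Let ii' : i != i'.
Proof. by rewrite -val_eqE /= i'E; lia. Qed.

Let iN : (i.+1 <= n)%N.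
Proof. exact: ltn_ord. Qed.

(** Two diagonal positions are comparable, so a diagonal matrix carries at most one decoration. *)
Lemma diag_small Z : offdiag Z set0 -> (forall p, p \in decor Z -> (p.1 <= i)%N) -> P Z.
Proof.
move=> oZ H; have [d0|[p pZ]] := set_0Vmem (decor Z); first exact: (gen_diag gP).
have eq q : q \in decor Z -> q.1 = q.2.
  by move=> /(decor_offdiag oZ)[//|]; rewrite inE.
apply: (vec_le (H p pZ) oZ); rewrite [X in (_, X)](eq p pZ) -surjective_pairing.
by apply: decor_single => // q qZ; rewrite -(eq q qZ) -(eq p pZ) !andbb leq_total.
Qed.

(** [Z] is the only term of the product of its undecorated matrix by a diagonal matrix decorated at
    (i, i): the vector lies in the space i+1 of [f'] but not in the space i, which excludes column
    i' and forces a decoration in column i. *)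
Lemma up_diag_vector Z : offdiag Z [set (i, i')] -> decor Z = [set (i, i)] -> P Z.
Proof.
move=> oZ dZ; pose r := @rowl _ _ Z; pose s := @coll _ _ Z.
have lZ := labelled_self Z; have cI := card_bidx Z; have [eZ dZ' aZ] := lZ.
have [X lX] := labelled_exists cI (antichain0 r s).
have lab x : x \in firsts Z -> (r x, s x) = (i, i).
  by move=> xK; apply/set1P; rewrite -dZ dZ'; apply/imsetP; exists x.
have aY : antichain s s (firsts Z).
  move=> x y xK yK ne; have := aZ x y xK yK ne.
  rewrite -/(r x) -/(s x) -/(r y) -/(s y).
  by have [-> ->] := lab x xK; have [-> ->] := lab y yK; rewrite !ltnn.
have [Y lY] := labelled_exists cI aY.
have eX : entry X =2 entry Z by move=> a b; have [-> _ _] := lX; rewrite eZ.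
have oX : offdiag X [set (i, i')] by move=> a b ne; rewrite eX oZ.
have dX : decor X = set0 by have [_ -> _] := lX; rewrite imset0.
have dY : decor Y = [set (i, i)].
  have [_ -> _] := lY; rewrite -dZ dZ'; apply: eq_in_imset => x xK.
  by have [ri si] := lab x xK; rewrite -/(r x) -/(s x) ri si.
have oY := labelled_diag lY.
apply: (gen_step gP (gen_up gP i'E dX oX) (vec_le (leqnn i) oY dY)).
  by apply: (relabel_config cI _ lX lY); rewrite ?set0U // -setI_eq0 set0I.
move=> Z1 [F [f [f' [f'' [w [m [o1 oX1 oY1]]]]]]] /eqP[].
have m0 := orbit_decor0 dX oX1; have ef := orbit_diag oY oY1; subst m f''.
rewrite subr0 in oY1.
have e1 : entry Z1 =2 entry Z by move=> a b; rewrite (orbit_entry o1 oX1) eX.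
have o1d : offdiag Z1 [set (i, i')] by move=> a b ne; rewrite e1 oZ.
apply: Xi_ext => //; rewrite dZ.
have w1 := mem_col oY1 iN; have w0 := mem_col oY1 (ltnW iN).
rewrite (mem_col o1 iN) (mem_col o1 (ltnW iN)) dY in w1 w0.
have {}w1 : forall p, p \in decor Z1 -> (p.2 <= i)%N.
  by apply/forall_inP; rewrite w1; apply/forall_inP => p; rewrite inE => /eqP ->.
have /forall_inPn[p p1 pi] : ~~ [forall p in decor Z1, (p.2 < i)%N].
  by rewrite w0; apply/forall_inPn; exists (i, i); rewrite ?inE //= ltnn.
have eq q : q \in decor Z1 -> q.1 = q.2.
  move=> q1; have [//|] := decor_offdiag o1d q1; have := w1 q q1.
  by rewrite inE => qi /eqP eq; move: qi; rewrite eq /=; lia.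
have ep : p = (i, i).
  have p2 : p.2 = i by apply/ord_inj/eqP; rewrite eqn_leq w1 //= leqNgt.
  by rewrite [p]surjective_pairing (eq p p1) p2.
rewrite -ep; apply: decor_single => // q q1.
by rewrite -(eq q q1) -(eq p p1) !andbb leq_total.
Qed.

(** With the decorated diagonal factor on the left, the vector lies in the space i+1 of [f] but not
    in the space i. The decoration is thus a single position of row i: either (i, i'), which gives
    [Z], or (i, i), which is [up_diag_vector]. *)
Lemma up_offdiag_vector Z : offdiag Z [set (i, i')] -> decor Z = [set (i, i')] -> P Z.
Proof.
move=> oZ dZ; pose r := @rowl _ _ Z; pose s := @coll _ _ Z.
have lZ := labelled_self Z; have cI := card_bidx Z; have [eZ dZ' aZ] := lZ.
have [Y lY] := labelled_exists cI (antichain0 r s).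
have lab x : x \in firsts Z -> (r x, s x) = (i, i').
  by move=> xK; apply/set1P; rewrite -dZ dZ'; apply/imsetP; exists x.
have aX : antichain r r (firsts Z).
  move=> x y xK yK ne; have := aZ x y xK yK ne.
  rewrite -/(r x) -/(s x) -/(r y) -/(s y).
  by have [-> ->] := lab x xK; have [-> ->] := lab y yK; rewrite !ltnn.
have [X lX] := labelled_exists cI aX.
have eY : entry Y =2 entry Z by move=> a b; have [-> _ _] := lY; rewrite eZ.
have oY : offdiag Y [set (i, i')] by move=> a b ne; rewrite eY oZ.
have dY : decor Y = set0 by have [_ -> _] := lY; rewrite imset0.
have dX : decor X = [set (i, i)].
  have [_ -> _] := lX; have := dZ; rewrite dZ' => dK.
  apply/setP => p; rewrite inE; apply/imsetP/eqP => [[x /lab[ri _] ->]|->].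
    by rewrite ri.
  have /imsetP[x xK [ri _]] : (i, i') \in [set (r x, s x) | x in firsts Z].
    by rewrite dK inE.
  by exists x; rewrite // -ri.
have oX := labelled_diag lX.
apply: (gen_step gP (vec_le (leqnn i) oX dX) (gen_up gP i'E dY oY)).
  by apply: (relabel_config cI _ lX lY); rewrite ?setU0 // -setI_eq0 setI0.
move=> Z1 [F [f [f' [f'' [w [m [o1 oX1 oY1]]]]]]] ne.
have /eqP := orbit_decor0 dY oY1; rewrite subr_eq0 => /eqP m0.
have ef := orbit_diag oX oX1; subst m f''.
have e1 : entry Z1 =2 entry Z by move=> a b; rewrite (orbit_entry o1 oY1) eY.
have o1d : offdiag Z1 [set (i, i')] by move=> a b ab; rewrite e1 oZ.
have w1 := mem_row oX1 iN; have w0 := mem_row oX1 (ltnW iN).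
rewrite (mem_row o1 iN) (mem_row o1 (ltnW iN)) dX in w1 w0.
have {}w1 : forall p, p \in decor Z1 -> (p.1 <= i)%N.
  by apply/forall_inP; rewrite w1; apply/forall_inP => p; rewrite inE => /eqP ->.
have /forall_inPn[p p1 pi] : ~~ [forall p in decor Z1, (p.1 < i)%N].
  by rewrite w0; apply/forall_inPn; exists (i, i); rewrite ?inE //= ltnn.
have p1i : p.1 = i by apply/ord_inj/eqP; rewrite eqn_leq w1 //= leqNgt.
have d1 : decor Z1 = [set p].
  apply: decor_single => // q q1; have := w1 q q1.
  have := decor_offdiag o1d q1; have := decor_offdiag o1d p1; rewrite !inE.
  by move=> [<-|/eqP ->] [<-|/eqP ->] /=; rewrite ?p1i => qi; clear -qi i'E; lia.
have [p12|] := decor_offdiag o1d p1; last first.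
  rewrite inE => /eqP ep; case/eqP: ne; apply: Xi_ext => //.
  by rewrite d1 dZ ep.
by apply: up_diag_vector => //; rewrite d1 [p]surjective_pairing -p12 p1i.
Qed.

(** A decoration beyond column i has row at most i, so it is off the diagonal and equals (i, i').
    Any further decoration is incomparable to it, which leaves only (i', i). *)
Lemma cross_decor Z : offdiag Z [set (i, i'); (i', i)] ->
  [forall p in decor Z, (p.1 < i.+1) || (p.2 < i.+1)]%N ->
  ~~ [forall p in decor Z, p.2 < i.+1]%N ->
  decor Z = [set (i, i')] \/ decor Z = [set (i, i'); (i', i)].
Proof.
move=> oZ /forall_inP H /forall_inPn[p pZ].
rewrite -leqNgt => pi.
have ep : p = (i, i').
  case: (decor_offdiag oZ pZ) => [ep|]; first by have := H p pZ; rewrite ep; lia.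
  by rewrite !inE => /orP[/eqP //|/eqP ep]; move: pi; rewrite ep /= ltnn.
subst p.
have sub q : q \in decor Z -> (q == (i, i')) || (q == (i', i)).
  move=> qZ; case: (decor_offdiag oZ qZ) => [eq|]; last by rewrite !inE.
  have qi : (q.1 <= i)%N by have := H q qZ; rewrite -eq; lia.
  by rewrite (decor_incomparable qZ pZ) ?eqxx //= -?eq //; lia.
have [qZ|qZ] := boolP ((i', i) \in decor Z); [right|left].
  apply/setP => q; rewrite !inE; apply/idP/idP; first exact: sub.
  by move=> /orP[] /eqP ->.
apply/setP => q; rewrite inE; apply/idP/eqP => [q1|->//].
by case/orP: (sub q q1) => /eqP // eq; rewrite eq (negPf qZ) in q1.
Qed.

(** A basis vector at (a, b) lies in the space l of [f'] but not in the space k of [f]. *)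
Lemma space_not_sub (F : finFieldType) X (f f' : flag F n d) w a b k l :
  in_orbit X f f' w -> (0 < entry X a b)%N -> (b < l <= n)%N -> (k <= a)%N ->
  ~~ (space f' l <= space f k)%VS.
Proof.
move=> /orbit_chart[g [bb cf cf' _]] /entry_label[x [rx sx]] /andP[bl ln] ka.
have kn : (k <= n)%N by apply: leq_trans ka (ltnW (ltn_ord a)).
apply/negP => /subvP/(_ (g x)); rewrite cf // cf' // mem_bspan1 /= ?sx // => /(_ isT).
by rewrite (mem_bspan bb) => /forallP/(_ x); rewrite /= rx -leqNgt ka (bcoordE bb) eqxx oner_eq0.
Qed.

(** Row k passes a unit from column i' to column i. In [X] this unit is either the off-diagonal
    entry at (i, i') or part of the diagonal entry at (i', i'). *)
Lemma moved_cross X Y k : offdiag X [set (i, i')] -> moved X Y (k, i') (k, i) ->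
  (k = i /\ offdiag Y set0) \/ (k = i' /\ offdiag Y [set (i, i'); (i', i)]).
Proof.
move=> oX mv; have ne : (k, i') != (k, i) by rewrite xpair_eqE eqxx eq_sym.
have := moved_gt0 mv ne; have [ki'|ki'] := eqVneq k i'; last first.
  rewrite oX //= inE xpair_eqE eqxx andbT; have [ki _|//] := eqVneq k i; left; split=> // a b ab.
  by have := mv a b; rewrite ki oX // !inE !xpair_eqE; move: ab; rewrite -!val_eqE /= ; lia.
move=> _; right; split=> // a b ab.
have := mv a b; rewrite ki' oX // !inE !xpair_eqE; move: ab; rewrite -!val_eqE /= i'E.
lia.
Qed.

Lemma cap_hyperplane (F : finFieldType) (U W V : {vspace 'rV[F]_d}) :
  (U <= V)%VS -> (U <= W)%VS -> \dim V = (\dim U).+1 -> ~~ (V <= W)%VS -> (V :&: W)%VS = U.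
Proof.
move=> UV UW dV VW; apply/esym/eqP; rewrite eqEdim subv_cap UV UW /=.
have := dimvS (capvSl V W); rewrite dV leq_eqVlt ltnS => /orP[/eqP e|//].
case/negP: VW; apply/capv_idPl/eqP; rewrite eqEdim capvSl /=; by rewrite e dV.
Qed.

Lemma add_hyperplane (F : finFieldType) (U W V : {vspace 'rV[F]_d}) :
  (U <= V)%VS -> (W <= V)%VS -> \dim V = (\dim U).+1 -> ~~ (W <= U)%VS -> (U + W)%VS = V.
Proof.
move=> UV WV dV WU; apply/eqP; rewrite eqEdim subv_add UV WV dV /=.
have := dimvS (addvSl U W); rewrite leq_eqVlt => /orP[/eqP e|//].
case/negP: WU; apply/addv_idPl/esym/eqP; rewrite eqEdim addvSl /=; by rewrite e.
Qed.

(** The left factor has its off-diagonal entry and its decoration at (i, i'), the right one is a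
    generator below the diagonal. Diagonal terms are known. In a term with both off-diagonal
    entries, the spaces i+1 of [f] and [f'] meet in that of [f''], which keeps the vector out of the
    one of [f'] and forces the decoration (i, i'). *)
Lemma cross_up_vector Z : offdiag Z [set (i, i'); (i', i)] -> decor Z = [set (i, i')] -> P Z.
Proof.
move=> oZ dZ; pose r := @rowl _ _ Z; pose s := @coll _ _ Z.
have lZ := labelled_self Z; have cI := card_bidx Z; have [eZ dZ' aZ] := lZ.
have lab x : x \in firsts Z -> (r x, s x) = (i, i').
  by move=> xK; apply/set1P; rewrite -dZ dZ'; apply/imsetP; exists x.
have [x1 [rx1 sx1]] : exists x : bidx Z, r x = i' /\ s x = i.
  by apply: entry_label; rewrite oZ 1?eq_sym // !inE eqxx orbT.
(* With column i' instead of i, the label [x1] is diagonal in the left factor and sits at (i', i) in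
   the right one. *)
pose t x := if x == x1 then i' else s x.
have tn y : y != x1 -> t y = s y by rewrite /t => /negPf ->.
have t1 : t x1 = i' by rewrite /t eqxx.
have ts x : x \in firsts Z -> t x = s x.
  move=> /lab[rx _]; apply: tn; apply: contraNneq ii' => ex.
  by rewrite -rx ex rx1.
have aX : antichain r t (firsts Z).
  by move=> x y xK yK ne; rewrite !ts //; exact: aZ.
have [X lX] := labelled_exists cI aX.
have [Y lY] := labelled_exists cI (antichain0 t s).
have oX : offdiag X [set (i, i')].
  have mv : moved Z X (r x1, s x1) (r x1, t x1) by apply: (labelled_moved lZ lX) => y /tn.
  move=> a b ab; rewrite rx1 sx1 t1 in mv; have := mv a b; rewrite oZ // !inE !xpair_eqE.
  by move: ab; rewrite -!val_eqE /= i'E; lia.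
have dX : decor X = [set (i, i')].
  by have [_ -> _] := lX; rewrite -dZ dZ'; apply: eq_in_imset => x xK; rewrite ts.
have oY : offdiag Y [set (i', i)].
  rewrite -t1 -[X in (_, X)]sx1.
  by apply: (labelled_offdiag1 lY) => //; rewrite t1 sx1 eq_sym.
have dY : decor Y = set0 by have [_ -> _] := lY; rewrite imset0.
have cZ : config X Y Z.
  by apply: (relabel_config cI _ lX lY); rewrite ?setU0 // -setI_eq0 setI0.
have mv Z1 : config X Y Z1 -> exists k, moved X Z1 (k, i') (k, i).
  move=> [F [f [f' [f'' [w [m [o1 oX1 oY1]]]]]]].
  have hyp := orbit_up i'E (offdiag_tr1 oY) (orbit_tr oY1).
  have [l mvl] := hyperplane_moved i'E hyp (orbit_tr oX1) (orbit_tr o1).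
  by exists l => a b; have := mvl b a; rewrite !entry_tr !xpair_eqE ![(b == _) && _]andbC.
have crossE Z1 : config X Y Z1 -> offdiag Z1 [set (i, i'); (i', i)] -> entry Z1 =2 entry Z.
  move=> c1 o1 a b; have [k1 mv1] := mv _ c1; have [k mvZ] := mv _ cZ.
  have kE Z2 k2 : offdiag Z2 [set (i, i'); (i', i)] -> moved X Z2 (k2, i') (k2, i) -> k2 = i'.
    move=> o2 /(moved_cross oX)[[_ o2']|[]//]; have := o2 i i' ii'.
    by rewrite o2' // !inE eqxx.
  by move: (mv1 a b) (mvZ a b); rewrite (kE _ _ o1 mv1) (kE _ _ oZ mvZ); clear; lia.
apply: (gen_step gP (up_offdiag_vector oX dX) (gen_down gP i'E dY oY) cZ).
move=> Z1 c1 ne; have [k mvk] := mv _ c1; have [F [f [f' [f'' [w [m [o1 oX1 oY1]]]]]]] := c1.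
have /eqP := orbit_decor0 dY oY1; rewrite subr_eq0 => /eqP m0; subst m.
have wi : w \in space f i.+1.
  by rewrite (mem_row oX1) // dX; apply/forall_inP => p; rewrite inE => /eqP ->.
have wi1 := wi; rewrite (mem_row o1) // in wi1.
case: (moved_cross oX mvk) => -[_ od1].
  by apply: diag_small => //; apply/forall_inP.
have [_ sY dYh] := orbit_up i'E (offdiag_tr1 oY) (orbit_tr oY1).
have [_ sX _] := orbit_up i'E oX oX1.
have w'i : w \notin space f' i.+1.
  apply/negP => w'.
  have : w \in (space f' i.+1 :&: space f i.+1)%VS by rewrite memv_cap w'.
  rewrite (cap_hyperplane sY sX dYh).
    by rewrite (mem_col oX1) // dX => /forall_inP/(_ (i, i')); rewrite inE eqxx /= i'E ltnn => /(_ isT).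
  have e0 : (0 < entry Z1 i' i)%N by rewrite od1 1?eq_sym // !inE eqxx orbT.
  by apply: (space_not_sub o1 e0); rewrite ?i'E ?leqnn.
rewrite (mem_col o1) // in w'i.
have wi2 : [forall p in decor Z1, (p.1 < i.+1) || (p.2 < i.+1)]%N.
  by apply/forall_inP => p /(forall_inP wi1) ->.
case: (cross_decor od1 wi2 w'i) => d1.
  by case/eqP: ne; apply: Xi_ext; [exact: crossE|rewrite d1 dZ].
by move/forall_inP: wi1 => /(_ (i', i)); rewrite d1 !inE eqxx orbT /= i'E ltnn => /(_ isT).
Qed.

(** The right factor adds a vector of the space i+1 of [f'] to one that lies in the space i+1 of [f]
    but not in that of [f']. By [cross_decor] the only other possible term is decorated at (i, i')
    alone. *)
Lemma cross_vector Z : offdiag Z [set (i, i'); (i', i)] ->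
  decor Z = [set (i, i'); (i', i)] -> P Z.
Proof.
move=> oZ dZ; pose r := @rowl _ _ Z; pose s := @coll _ _ Z.
have lZ := labelled_self Z; have cI := card_bidx Z; have [eZ _ _] := lZ.
have [x0 [rx0 sx0]] : exists x : bidx Z, r x = i /\ s x = i'.
  by apply: entry_label; rewrite oZ // !inE eqxx.
have [x1 [rx1 sx1]] : exists x : bidx Z, r x = i' /\ s x = i.
  by apply: entry_label; rewrite oZ 1?eq_sym // !inE eqxx orbT.
have x01 : x0 != x1 by apply: contraNneq ii' => ex; rewrite -rx0 -rx1 ex.
have lZ2 : labelled r s ([set x0] :|: [set x1]) Z.
  split=> //; first by rewrite dZ imsetU !imset_set1 rx0 sx0 rx1 sx1.
  move=> x y; rewrite !inE => /orP[] /eqP -> /orP[] /eqP ->; rewrite ?eqxx //.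
    by rewrite rx0 sx0 rx1 sx1 i'E ltnSn.
  by rewrite rx0 sx0 rx1 sx1 i'E ltnSn orbT.
have [X lX] := labelled_exists cI (@antichain1 _ _ r s x0).
have [Y lY] := labelled_exists cI (@antichain1 _ _ s s x1).
have eX : entry X =2 entry Z by move=> a b; have [-> _ _] := lX; rewrite eZ.
have oX : offdiag X [set (i, i'); (i', i)] by move=> a b ne; rewrite eX oZ.
have dX : decor X = [set (i, i')] by have [_ -> _] := lX; rewrite imset_set1 rx0 sx0.
have oY := labelled_diag lY.
have dY : decor Y = [set (i, i)] by have [_ -> _] := lY; rewrite imset_set1 sx1.
apply: (gen_step gP (cross_up_vector oX dX) (vec_le (leqnn i) oY dY)).
  by apply: (relabel_config cI _ lX lY lZ2); rewrite disjoints1 inE.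
move=> Z1 [F [f [f' [f'' [w [m [o1 oX1 oY1]]]]]]] ne.
have ef := orbit_diag oY oY1; subst f''.
have e1 : entry Z1 =2 entry Z by move=> a b; rewrite (orbit_entry o1 oX1) eX.
have od1 : offdiag Z1 [set (i, i'); (i', i)] by move=> a b ab; rewrite e1 oZ.
have mi : m \in space f i.+1.
  by rewrite (mem_row oX1) // dX; apply/forall_inP => p; rewrite inE => /eqP ->.
have wmi : w - m \in space f' i.+1.
  by rewrite (mem_col oY1) // dY; apply/forall_inP => p; rewrite inE => /eqP ->.
have mi' : m \notin space f' i.+1.
  rewrite (mem_col oX1) // dX; apply/forall_inPn; exists (i, i'); rewrite ?inE //=.
  by rewrite i'E ltnn.
have wi : w \in (space f i.+1 + space f' i.+1)%VS.
  by rewrite -(subrK m w) addrC memv_add.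
have wi' : w \notin space f' i.+1.
  by apply: contra mi' => w'; rewrite -(subKr w m) rpredB.
rewrite (mem_rowcol o1) // in wi; rewrite (mem_col o1) // in wi'.
case: (cross_decor od1 wi wi') => d1; first exact: cross_up_vector.
by case/eqP: ne; apply: Xi_ext => //; rewrite d1 dZ.
Qed.

(** In a diagonal term the vector lies in the space i'+1 of [f], so the decoration is at most at
    (i', i'). In a term with both off-diagonal entries, the spaces i+1 of [f] and [f'] span that of
    [f''], which contains the vector, and [cross_decor] applies. *)
Lemma next_diag_vector Z : offdiag Z set0 -> decor Z = [set (i', i')] -> P Z.
Proof.
move=> oZ dZ; pose r := @rowl _ _ Z; pose s := @coll _ _ Z.
have lZ := labelled_self Z; have cI := card_bidx Z; have [eZ dZ' aZ] := lZ.
have rs x : r x = s x.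
  by have [//|/(offdiag_label oZ)] := eqVneq (rowl x) (coll x); rewrite inE.
have /imsetP[x0 x0K [rx0 _]] : (i', i') \in [set (r x, s x) | x in firsts Z].
  by rewrite -dZ' dZ inE.
have lab x : x \in firsts Z -> r x = i'.
  by move=> xK; have /set1P[] : (r x, s x) \in [set (i', i')] by rewrite -dZ dZ'; apply/imsetP; exists x.
have firstsE x : x \in firsts Z -> x = x0.
  move=> xK; apply/eqP/contraT => ne; have := aZ x x0 xK x0K ne.
  by rewrite -/(r x) -/(r x0) -/(s x) -/(s x0) -!rs (lab x) // -rx0 ltnn.
pose t x := if x == x0 then i else r x.
have tn y : y != x0 -> t y = r y by rewrite /t => /negPf ->.
have t0 : t x0 = i by rewrite /t eqxx.
have [X lX] := labelled_exists cI (antichain0 r t).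
have aY : antichain t s (firsts Z).
  by move=> x y /firstsE -> /firstsE ->; rewrite eqxx.
have [Y lY] := labelled_exists cI aY.
have oX : offdiag X [set (i', i)].
  rewrite rx0 -t0; apply: (labelled_offdiag1 lX); first by rewrite t0 -rx0 eq_sym.
  by move=> y /tn.
have dX : decor X = set0 by have [_ -> _] := lX; rewrite imset0.
have oY : offdiag Y [set (i, i')].
  rewrite rx0 -t0 rs; apply: (labelled_offdiag1 lY); first by rewrite t0 -rs -rx0.
  by move=> y /tn ->.
have dY : decor Y = [set (i, i')].
  have [_ -> _] := lY; have -> : firsts Z = [set x0].
    by apply/setP => x; rewrite inE; apply/idP/eqP => [/firstsE|->].
  by rewrite imset_set1 t0 -rs -rx0.
have cZ : config X Y Z.
  by apply: (relabel_config cI _ lX lY); rewrite ?set0U // -setI_eq0 set0I.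
have mv Z1 : config X Y Z1 ->
    exists l, [/\ moved Z1 Y (i', l) (i, l) & (l = i' /\ offdiag Z1 set0) \/
      (l = i /\ offdiag Z1 [set (i, i'); (i', i)])].
  move=> [F [f [f' [f'' [w [m [o1 oX1 oY1]]]]]]].
  have hyp := orbit_up i'E (offdiag_tr1 oX) (orbit_tr oX1).
  have [l mvl] := hyperplane_moved i'E hyp o1 oY1; exists l; split=> //.
  have nel : (i', l) != (i, l) by rewrite xpair_eqE eqxx andbT eq_sym.
  have := moved_gt0r mvl nel; have [li|li] := eqVneq l i.
    right; split=> // a b ab.
    have := mvl a b; rewrite li oY // !inE !xpair_eqE; move: ab; rewrite -!val_eqE /= i'E.
    lia.
  rewrite oY 1?eq_sym //= inE xpair_eqE eqxx; have [li' _|//] := eqVneq l i'.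
  left; split=> // a b ab.
  have := mvl a b; rewrite li' oY // !inE !xpair_eqE; move: ab; rewrite -!val_eqE /= i'E; lia.
apply: (gen_step gP (gen_down gP i'E dX oX) (up_offdiag_vector oY dY) cZ).
move=> Z1 c1 ne; have [l [mvl cases]] := mv _ c1.
have [F [f [f' [f'' [w [m [o1 oX1 oY1]]]]]]] := c1.
have m0 := orbit_decor0 dX oX1; subst m; rewrite subr0 in oY1.
have [eV sV dV] := orbit_up i'E (offdiag_tr1 oX) (orbit_tr oX1).
have [_ sV' dV'] := orbit_up i'E oY oY1.
have w'' : w \in space f'' i.+1.
  by rewrite (mem_row oY1) // dY; apply/forall_inP => p; rewrite inE => /eqP ->.
have w' : w \notin space f' i.+1.
  rewrite (mem_col oY1) // dY; apply/forall_inPn; exists (i, i'); rewrite ?inE //=.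
  by rewrite i'E ltnn.
case: cases => -[li od1].
  have i'n : (i'.+1 <= n)%N by exact: ltn_ord.
  have wi' : w \in space f i'.+1.
    rewrite -eV //; last by rewrite i'E; clear; lia.
    by apply: (subvP (space_mono _ _)) w''; rewrite i'n andbT i'E ltnS leqnSn.
  rewrite (mem_row o1) // in wi'; move/forall_inP: wi' => wi'.
  have [d1|/set0Pn[p p1]] := eqVneq (decor Z1) set0; first exact: (gen_diag gP).
  have dg q : q \in decor Z1 -> q.1 = q.2.
    by move=> /(decor_offdiag od1)[//|]; rewrite inE.
  have d1 : decor Z1 = [set p].
    by apply: decor_single => // q q1; rewrite -(dg q q1) -(dg p p1) !andbb leq_total.
  have [pi|pi] := leqP p.1 i.
    by apply: diag_small => // q; rewrite d1 inE => /eqP->.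
  have ep : p.1 = i' by apply: ord_inj; have := wi' p p1; rewrite i'E; move: pi; clear; lia.
  case/eqP: ne; apply: Xi_ext; last by rewrite d1 dZ [p]surjective_pairing -(dg p p1) ep.
  (* [Z] is diagonal too, so it arises from [Y] by the same move as [Z1]. *)
  have [lz [mvz [[lzi' _]|[_ oZ']]]] := mv _ cZ.
    by move=> a b; move: (mvl a b) (mvz a b); rewrite li lzi'; clear; lia.
  by have := oZ' i i' ii'; rewrite oZ // !inE eqxx.
have wi : w \in (space f i.+1 + space f' i.+1)%VS.
  rewrite (add_hyperplane sV sV' dV) //.
  have e0 : (0 < entry Z1 i' i)%N by rewrite od1 1?eq_sym // !inE eqxx orbT.
  by apply: (space_not_sub o1 e0); rewrite ?i'E ?leqnn.
rewrite (mem_rowcol o1) // in wi; rewrite (mem_col o1) // in w'.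
case: (cross_decor od1 wi w') => d1; first exact: cross_up_vector.
exact: cross_vector.
Qed.

End DiagonalVectors.

(** * Reduction to diagonal matrices *)

Section Reduction.
Variables (n d : nat).
Implicit Types (X Y Z : Xi n d) (P : pred (Xi n d)).

Lemma diag_generated P Z : generated P -> offdiag Z set0 -> P Z.
Proof.
move=> gP; suff vec m Y (k : 'I_n) : (k <= m)%N -> offdiag Y set0 -> decor Y = [set (k, k)] -> P Y.
  move=> oZ; have [d0|[p pZ]] := set_0Vmem (decor Z); first exact: (gen_diag gP).
  apply: (diag_small gP (i := p.1)) => // [Y k _|q qZ]; first exact: vec (leqnn k).
  have eq u : u \in decor Z -> u.1 = u.2.
    by move=> /(decor_offdiag oZ)[//|]; rewrite inE.
  have [//|pq] := leqP q.1 p.1.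
  suff epq : p = q by rewrite epq ltnn in pq.
  by apply: (decor_incomparable pZ qZ); rewrite -?(eq p pZ) -?(eq q qZ) ltnW.
elim: m Y k => [|m IH] Y k; first by rewrite leqn0 => /eqP k0 oY dY; apply: (gen_vector gP k0).
rewrite leq_eqVlt => /orP[/eqP km|]; last exact: IH.
have mn : (m < n)%N by have := ltn_ord k; rewrite km => /ltnW.
by apply: (next_diag_vector gP (i := Ordinal mn)) => //= Y' k'; apply: IH.
Qed.

(** One of the two truncated differences vanishes, so this is the square of |a - b|. *)
Definition sqdist a b := ((a - b + (b - a)) ^ 2)%N.

Definition spread X := (\sum_(p : 'I_n * 'I_n) entry X p.1 p.2 * sqdist p.1 p.2)%N.

Lemma sqdistE a b : (sqdist a b + 2 * (a * b) = a ^ 2 + b ^ 2)%N.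
Proof. by rewrite /sqdist; case: (leqP a b) => ab; nia. Qed.

Lemma sqdistC a b : sqdist a b = sqdist b a.
Proof. by rewrite /sqdist addnC. Qed.

(** The two sides differ by 2(j - l). *)
Lemma sqdist_exchange h l j : (l < j)%N ->
  (sqdist h l + sqdist h.+1 j < sqdist h.+1 l + sqdist h j)%N.
Proof.
move: (sqdistE h l) (sqdistE h.+1 j) (sqdistE h.+1 l) (sqdistE h j).
by rewrite !expnS !expn0; nia.
Qed.

Lemma sqdist_lt h j : (h < j)%N -> (sqdist h.+1 j < sqdist h j)%N.
Proof. by move: (sqdistE h.+1 j) (sqdistE h j); rewrite !expnS !expn0; nia. Qed.

Lemma spread_moved X Y p q : moved X Y p q ->
  (spread Y + sqdist p.1 p.2 = spread X + sqdist q.1 q.2)%N.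
Proof.
move=> mv; have cell (u : 'I_n * 'I_n) :
    (\sum_(c : 'I_n * 'I_n) (c == u) * sqdist c.1 c.2 = sqdist u.1 u.2)%N.
  by rewrite (bigD1 u) //= eqxx mul1n big1 ?addn0 // => c /negPf ->.
rewrite -!cell -!big_split; apply: eq_bigr => -[a c] _ /=.
by rewrite -!mulnDl mv.
Qed.

Lemma ideal_space_mono (F : finFieldType) (f f' f'' : flag F n d) D :
  (forall k, (k <= n)%N -> (space f'' k <= space f k)%VS) ->
  (ideal_space f'' f' D <= ideal_space f f' D)%VS.
Proof.
move=> H; apply/subv_sumP => q qD; apply: (subv_trans _ (sumv_sup q qD (subvv _))).
by apply: capvS => //; apply: H.
Qed.

Lemma hyperplane_le (F : finFieldType) (h : 'I_n) (f f'' : flag F n d) k :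
  hyperplane_at h f f'' -> (k <= n)%N -> (space f'' k <= space f k)%VS.
Proof.
move=> [e s _] kn; have [->//|kh] := eqVneq k h.+1; by rewrite e.
Qed.

(** Moving a unit of [Z] from (h, j) down to row h+1 gives the right factor [Y], of smaller spread.
    Every term of the product lifts a unit of [Y] back in some column l. For l = j it has the matrix
    of [Z] and a dominated decoration, for l < j a smaller spread, and l > j is impossible as row
    h+1 of [Z] vanishes there. *)
Lemma left_step P Z (h j : 'I_n) : generated P ->
  (forall Y, (spread Y < spread Z)%N -> P Y) ->
  (forall Y, entry Y =2 entry Z -> dominated (decor Y) (decor Z) -> Y != Z -> P Y) ->
  (h < j)%N -> (0 < entry Z h j)%N -> (h, j) \notin decor Z ->
  (forall k l : 'I_n, k = h.+1 :> nat -> (j < l)%N -> entry Z k l = 0%N) -> P Z.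
Proof.
move=> gP smaller same hj /entry_label[x0 [rx0 sx0]] hjD row0.
have h'n : (h.+1 < n)%N by apply: leq_ltn_trans hj (ltn_ord j).
pose h' := Ordinal h'n; have h'E : h' = h.+1 :> nat by [].
have hh' : h != h' by rewrite -val_eqE /= ltn_eqF.
pose r := @rowl _ _ Z; pose s := @coll _ _ Z.
have lZ := labelled_self Z; have cI := card_bidx Z; have [eZ dZ aZ] := lZ.
pose t x := if x == x0 then h' else r x.
have tn y : y != x0 -> t y = r y by rewrite /t => /negPf ->.
have t0 : t x0 = h' by rewrite /t eqxx.
have x0K : x0 \notin firsts Z.
  by apply: contra hjD => x0K; rewrite dZ; apply/imsetP; exists x0; rewrite // rx0 sx0.
have tK x : x \in firsts Z -> t x = r x.
  by move=> xK; apply: tn; apply: contraNneq x0K => <-.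
have [X lX] := labelled_exists cI (antichain0 r t).
have aY : antichain t s (firsts Z) by move=> x y xK yK ne; rewrite !tK //; exact: aZ.
have [Y lY] := labelled_exists cI aY.
have oX : offdiag X [set (h, h')].
  rewrite -rx0 -t0 -/(r x0).
  by apply: (labelled_offdiag1 lX) => [|y /tn->]; rewrite ?t0 /r ?rx0.
have dX : decor X = set0 by have [_ -> _] := lX; rewrite imset0.
have dY : decor Y = decor Z.
  by have [_ -> _] := lY; rewrite dZ; apply: eq_in_imset => x xK; rewrite tK.
have mvY : moved Z Y (h, j) (h', j).
  by rewrite -rx0 -sx0 -t0; apply: (labelled_moved lZ lY) => y /tn.
have spY := spread_moved mvY; rewrite /= in spY.
have ltYZ : (spread Y < spread Z)%N.
  by move: spY (sqdist_lt hj); clear; lia.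
apply: (gen_step gP (gen_up gP h'E dX oX) (smaller Y ltYZ)).
  by apply: (relabel_config cI _ lX lY); rewrite ?set0U // -setI_eq0 set0I.
move=> Z1 [F [f [f' [f'' [w [m [o1 oX1 oY1]]]]]]] ne.
have m0 := orbit_decor0 dX oX1; subst m; rewrite subr0 in oY1.
have hyp := orbit_up h'E oX oX1.
have [l mvl] := hyperplane_moved h'E hyp oY1 o1.
(* The spaces of [f''] lie in those of [f], so the vector stays in the ideal space of the decoration
   of [Z]. *)
have dom : dominated (decor Z1) (decor Z).
  rewrite -(mem_ideal _ o1) -dY.
  have sub := ideal_space_mono f' (decor Y) (fun k => @hyperplane_le _ _ _ _ k hyp).
  by apply: (subvP sub); rewrite (mem_ideal _ oY1) dominated_refl.
have [lj|lj] := eqVneq l j.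
  by apply: same => // a b; move: (mvl a b) (mvY a b); rewrite lj; clear; lia.
apply: smaller; have sp1 := spread_moved mvl; rewrite /= in sp1.
have ltlj : (l < j)%N.
  rewrite ltn_neqAle val_eqE lj /= leqNgt; apply/negP => jl.
  have : (0 < entry Y h' l)%N.
    by apply: (moved_gt0 mvl); rewrite xpair_eqE eqxx andbT eq_sym.
  have := mvY h' l; rewrite !xpair_eqE (negPf lj) !andbF (row0 h' l) //; clear; lia.
by move: sp1 spY (sqdist_exchange h ltlj); clear; lia.
Qed.

(** A unit at (h, j) is moved to column j-1 to form the left factor, whose decoration is only known
    to be dominated by that of [Z]. Every term moves a unit back in some row k. The condition on
    column j-1 excludes k < h, the spread is smaller for k > h, and k = h requires a comparison of
    ideal spaces. *)
Lemma right_step P Z (h j : 'I_n) : generated P -> covering n d ->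
  (forall Y, (spread Y < spread Z)%N -> P Y) ->
  (forall Y, entry Y =2 entry Z -> dominated (decor Y) (decor Z) -> Y != Z -> P Y) ->
  (h < j)%N -> (0 < entry Z h j)%N ->
  (exists q, [/\ q \in decor Z, (h <= q.1)%N & (j <= q.2)%N]) ->
  (forall k l : 'I_n, (k < h)%N -> j = l.+1 :> nat -> entry Z k l = 0%N) -> P Z.
Proof.
move=> gP cov smaller same hj /entry_label[x0 [rx0 sx0]] [q0 [q0D hq0 jq0]] col0.
have i_n : (j.-1 < n)%N := leq_ltn_trans (leq_pred j) (ltn_ord j).
have [i jE] : exists i : 'I_n, j = i.+1 :> nat.
  by exists (Ordinal i_n); rewrite /= prednK // (leq_ltn_trans _ hj).
have ij : i != j by rewrite -val_eqE /= jE ltn_eqF.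
have hi : (h <= i)%N by have := hj; rewrite jE.
have iN : (i.+1 <= n)%N by exact: ltn_ord.
pose r := @rowl _ _ Z; pose s := @coll _ _ Z.
have lZ := labelled_self Z; have cI := card_bidx Z; have [eZ dZ aZ] := lZ.
pose t x := if x == x0 then i else s x.
have tn y : y != x0 -> t y = s y by rewrite /t => /negPf ->.
have t0 : t x0 = i by rewrite /t eqxx.
have [Y lY] := labelled_exists cI (antichain0 t s).
have oY : offdiag Y [set (i, j)].
  rewrite -t0 -sx0 -/(s x0).
  by apply: (labelled_offdiag1 lY) => [|y /tn->]; rewrite ?t0 /s ?sx0.
have dY : decor Y = set0 by have [_ -> _] := lY; rewrite imset0.
(* If [x0] is a summand of the vector, its new position may be comparable to that of another
   summand, so it is split off. *)
pose K1 := firsts Z :&: [set x0]; pose K2 := firsts Z :\ x0.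
have dK : [disjoint K1 & K2].
  by apply/pred0P => x /=; rewrite in_setI in_setD1 in_set1; case: (x == x0); rewrite ?andbF.
have KE : K1 :|: K2 = firsts Z.
  exact: setID.
have a1 : antichain r r K1.
  by move=> x y; rewrite !in_setI !in_set1 => /andP[_ /eqP ->] /andP[_ /eqP ->]; rewrite eqxx.
have a2 : antichain r t K2.
  by move=> x y; rewrite !in_setD1 => /andP[nx xK] /andP[ny yK] ne; rewrite !tn //; exact: aZ.
have HD x : x \in K1 :|: K2 -> exists q, [/\ q \in decor Z, (r x <= q.1)%N & (t x <= q.2)%N].
  rewrite KE => xK; have [->|nx] := eqVneq x x0.
    exists q0; split=> //; first by rewrite /r rx0.
    by rewrite t0; apply: leq_trans jq0; rewrite jE.
  by exists (r x, s x); rewrite tn // dZ; split=> //; apply/imsetP; exists x.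
rewrite -/r -/s -KE in lZ.
have [X [cX domX eX]] := relabel_config_covering cov cI dK a1 a2 lY lZ HD.
have mvX : moved Z X (h, j) (h, i).
  have [Z' lZ'] := labelled_exists cI (antichain0 r t).
  move=> a b; have <- : entry Z' a b = entry X a b by have [-> _ _] := lZ'; rewrite eX.
  have := labelled_moved (x := x0) lZ lZ' (fun y ny => conj erefl (tn y ny)).
  by rewrite t0 /r /s rx0 sx0; apply.
have spX := spread_moved mvX; rewrite /= in spX.
have ltXZ : (spread X < spread Z)%N.
  have sq : (sqdist h i < sqdist h j)%N by rewrite jE /sqdist; move: hi; clear; nia.
  by move: spX sq; clear; lia.
apply: (gen_step gP (smaller X ltXZ) (gen_up gP jE dY oY) cX).
move=> Z1 [F [f [f' [f'' [w [m [o1 oX1 oY1]]]]]]] ne.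
have /eqP := orbit_decor0 dY oY1; rewrite subr_eq0 => /eqP m0; subst m.
have hyp := orbit_up jE oY oY1; have [eV sV dV] := hyp.
have [k mvk'] := hyperplane_moved jE hyp (orbit_tr o1) (orbit_tr oX1).
have mvk : moved Z1 X (k, j) (k, i).
  by move=> a b; have := mvk' b a; rewrite !entry_tr !xpair_eqE ![(b == _) && _]andbC.
have hk : (h <= k)%N.
  rewrite leqNgt; apply/negP => kh.
  have : (0 < entry X k i)%N.
    by apply: (moved_gt0r mvk); rewrite xpair_eqE eqxx /= eq_sym.
  have := mvX k i; rewrite !xpair_eqE (col0 k i) // -val_eqE (ltn_eqF kh) /=; clear; lia.
have [ekh|kh] := eqVneq k h; last first.
  apply: smaller; have sp1 := spread_moved mvk; rewrite /= in sp1.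
  have {hk kh} hk : (h < k)%N by rewrite ltn_neqAle hk andbT eq_sym val_eqE.
  have := sqdist_exchange i hk; rewrite -jE ![sqdist _ h]sqdistC ![sqdist _ k]sqdistC.
  by move: sp1 spX; clear; lia.
rewrite ekh in mvk.
have e1 : entry Z1 =2 entry Z by move=> a b; move: (mvk a b) (mvX a b); clear; lia.
apply: same => //; rewrite -(mem_ideal _ o1).
(* The flags [f''] and [f'] differ only in the space i+1, so only decorations in column i need an
   argument. *)
suff sub : (ideal_space f f'' (decor Z) <= ideal_space f f' (decor Z))%VS.
  by apply: (subvP sub); rewrite (mem_ideal _ oX1).
have le'' := hyperplane_le hyp.
have rkE a : (a <= n)%N -> \dim (space f a :&: space f'' i.+1) =
    (\dim (space f a :&: space f' i.+1) + (h < a))%N.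
  move=> an; rewrite (orbit_rk o1) // (orbit_rk oX1) //.
  by have := rk_moved a i.+1 mvk; rewrite /= jE !ltnS leqnn ltnn; case: (h < a)%N; clear; lia.
apply/subv_sumP => q qD.
have [qi|qi] := eqVneq q.2 i; last first.
  rewrite eV // ?eqSS ?val_eqE //; exact: (sumv_sup q qD (subvv _)).
have qn : (q.1.+1 <= n)%N by exact: ltn_ord.
have below : (space f q.1.+1 :&: space f' i.+1 <= ideal_space f f' (decor Z))%VS.
  by rewrite -qi; apply: (sumv_sup q qD (subvv _)).
(* The space i+1 of [f''] lies in its space j+1, which is also that of [f'], and [q0] dominates (h,
   j). *)
have top : (space f h.+1 :&: space f'' i.+1 <= ideal_space f f' (decor Z))%VS.
  apply: (subv_trans _ (sumv_sup q0 q0D (subvv _))); apply: capvS.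
    by apply: space_mono; rewrite ltnS hq0 ltn_ord.
  have jn : (j.+1 <= n)%N by exact: ltn_ord.
  apply: (@subv_trans _ _ (space f'' j.+1)); first by apply: space_mono; rewrite jn jE leqnSn.
  rewrite eV //; last by rewrite eqSS jE; clear; lia.
  by apply: space_mono; rewrite ltnS jq0 ltn_ord.
rewrite qi; have [hq|qh] := leqP h q.1; last first.
  have -> : (space f q.1.+1 :&: space f'' i.+1 = space f q.1.+1 :&: space f' i.+1)%VS.
    have z : (h < q.1.+1)%N = false by rewrite ltnS leqNgt qh.
    apply/esym/eqP; rewrite eqEdim rkE // z addn0 leqnn andbT.
    by apply: capvS => //; apply: le''.
  exact: below.
have hn : (h.+1 <= n)%N by exact: ltn_ord.
(* For h <= q.1 the intersection with [f''] has one dimension more than that with [f']; the subspace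
   in [top] supplies it. *)
rewrite -(@add_hyperplane _ _ (space f q.1.+1 :&: space f' i.+1)
  (space f h.+1 :&: space f'' i.+1) (space f q.1.+1 :&: space f'' i.+1)).
- by rewrite subv_add below top.
- by apply: capvS => //; apply: le''.
- by apply: capvS => //; apply: space_mono; rewrite ltnS hq.
- by rewrite rkE // ltnS hq addn1.
apply/negP => sub.
have : (space f h.+1 :&: space f'' i.+1 <= space f h.+1 :&: space f' i.+1)%VS.
  rewrite subv_cap capvSl; exact: subv_trans sub (capvSr _ _).
by move=> /dimvS; rewrite rkE // ltnSn addn1 ltnn.
Qed.

Lemma upper_step P Z (a b : 'I_n) : generated P -> covering n d ->
  (forall Y, (spread Y < spread Z)%N -> P Y) ->
  (forall Y, entry Y =2 entry Z -> dominated (decor Y) (decor Z) -> Y != Z -> P Y) ->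
  (a < b)%N -> (0 < entry Z a b)%N -> P Z.
Proof.
move=> gP cov smaller same ab abZ.
pose U := [pred p : 'I_n * 'I_n | (p.1 < p.2)%N && (0 < entry Z p.1 p.2)%N].
have U0 : U (a, b) by rewrite /= ab.
have row0 k l : ~~ U (k, l) -> (k < l)%N -> entry Z k l = 0%N.
  by move=> /= + kl; rewrite kl /= lt0n negbK => /eqP.
case: (arg_maxnP (fun p : 'I_n * 'I_n => p.1 : nat) U0) => -[h j] /= /andP[hj hjZ] hmax.
have [hjD|hjD] := boolP ((h, j) \in decor Z); last first.
  (* A nonzero entry of row h+1 right of column j would be above the diagonal, against the
     maximality of [h]. *)
  apply: (left_step gP smaller same hj hjZ hjD) => k l kh jl.
  apply: row0; last by rewrite kh; apply: leq_trans jl.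
  by apply/negP => /(hmax (k, l)) /=; rewrite kh ltnn.
(* The decorated position (h, j) dominates the leftmost one (h2, j2), by maximality of h and
   minimality of j2. *)
case: (arg_minnP (fun p : 'I_n * 'I_n => p.2 : nat) U0) => -[h2 j2] /= /andP[hj2 hjZ2] jmin.
apply: (right_step gP cov smaller same hj2 hjZ2) => [|k l kh jl].
  exists (h, j); split=> //=; first by apply: (hmax (h2, j2)); rewrite /= hj2.
  by apply: (jmin (h, j)); rewrite /= hj.
apply: row0; last by have := hj2; rewrite jl ltnS; apply: leq_trans.
by apply/negP => /(jmin (k, l)) /=; rewrite jl ltnn.
Qed.

Lemma dominated_tr X Y : dominated (decor X) (decor Y) -> dominated (decor (tr X)) (decor (tr Y)).
Proof.
move=> /dominatedP H; apply/dominatedP => p; rewrite mem_decor_tr => /H[q [qY q1 q2]].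
by exists (q.2, q.1); split=> //; rewrite mem_decor_tr /= -surjective_pairing.
Qed.

Lemma spread_tr X : spread (tr X) = spread X.
Proof.
rewrite /spread (reindex_inj (h := fun p : 'I_n * 'I_n => (p.2, p.1))) /=; last first.
  by apply: (can_inj (g := fun p => (p.2, p.1))) => -[].
by apply: eq_bigr => p _; rewrite entry_tr sqdistC.
Qed.

(** This is the order ideal generated by the decoration; its cardinality is the inner induction
    measure. *)
Definition shadow X : {set 'I_n * 'I_n} :=
  [set p : 'I_n * 'I_n | [exists q in decor X, (p.1 <= q.1) && (p.2 <= q.2)]%N].

Lemma shadow_lt X Y : entry X =2 entry Y -> dominated (decor X) (decor Y) -> X != Y ->
  (#|shadow X| < #|shadow Y|)%N.
Proof.
move=> e XY ne; apply: proper_card; rewrite properEneq; apply/andP; split.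
  apply: contra ne => /eqP sh; apply/eqP/Xi_ext => //; apply: dominated_decor_eq => //.
  apply/dominatedP => p pY; have : p \in shadow X.
    by rewrite sh inE; apply/existsP; exists p; rewrite pY !leqnn.
  by rewrite inE => /existsP[q /and3P[]]; exists q.
apply/subsetP => p; rewrite !inE => /existsP[q /and3P[qX p1 p2]].
have /dominatedP/(_ q qX)[u [uY q1 q2]] := XY.
by apply/existsP; exists u; rewrite uY (leq_trans p1 q1) (leq_trans p2 q2).
Qed.

Theorem generated_all P : generated P -> covering n d -> forall Z, P Z.
Proof.
move=> gP cov Z; have [N] := ubnP (spread Z); elim: N Z => // N IHN Z ltN.
have [M] := ubnP #|shadow Z|; elim: M Z ltN => // M IHM Z ltN ltM.
have smaller Y : (spread Y < spread Z)%N -> P Y.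
  by move=> lt; apply: IHN; apply: leq_trans lt _.
have same Y : entry Y =2 entry Z -> dominated (decor Y) (decor Z) -> Y != Z -> P Y.
  move=> e dom ne; apply: IHM; last exact: leq_trans (shadow_lt e dom ne) _.
  by rewrite /spread (eq_bigr _ (fun p _ => congr1 (muln^~ _) (e p.1 p.2))).
have [/existsP[p /andP[ne pZ]]|/existsPn no] :=
    boolP [exists p : 'I_n * 'I_n, (p.1 != p.2) && (0 < entry Z p.1 p.2)%N].
  case: (ltngtP p.1 p.2) => [lt|gt|eq]; last by case/eqP: ne; exact: ord_inj.
    exact: (upper_step gP cov smaller same lt pZ).
  (* An entry below the diagonal is treated on the transpose, which has the same spread. *)
  rewrite -[Z]trK; apply: (upper_step (P := fun X => P (tr X)) (generated_tr gP) cov _ _ gt).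
  - by move=> Y; rewrite spread_tr => lt; apply: smaller; rewrite spread_tr.
  - move=> Y e dom neY; apply: same.
    + by move=> a b; rewrite entry_tr e entry_tr.
    + by rewrite -[Z]trK; apply: dominated_tr.
    by apply: contra neY => /eqP <-; rewrite trK.
  by rewrite entry_tr.
apply: (diag_generated gP) => a b ab; have := no (a, b).
by rewrite /= ab inE lt0n negbK => /eqP.
Qed.

End Reduction.

(** * Laurent polynomials *)

Section Laurent.

(** The sum of the absolute values of the exponents bounds each of them, so the factor x^N clears
    all denominators, uniformly in the field and in x. *)
Lemma laurent_poly (p : laurent) : exists N (Q : {poly int}),
  forall (K : fieldType) (x : K), x != 0 ->
    laurent_eval x p * x ^+ N = (map_poly intr Q).[x].
Proof.
pose N := (\sum_(k <- finsupp p) absz k)%N.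
exists N, (\sum_(k <- finsupp p) (p k) *: 'X^(absz (k + N%:Z))) => K x x0.
rewrite /laurent_eval mulr_suml rmorph_sum horner_sum !big_seq; apply: eq_bigr => k ks.
rewrite -mul_polyC rmorphM /= map_polyC map_polyXn hornerM hornerC hornerXn /= -mulrA.
congr (_ * _); rewrite !exprnP -expfzDr //.
have kN : (absz k <= N)%N by rewrite /N (big_rem k) //= leq_addr.
by congr (x ^ _); lia.
Qed.

Lemma v_neq0 : v != 0.
Proof. by rewrite /v tofrac_eq0 polyX_eq0. Qed.

(** As [tofrac] is injective, this makes [v] transcendental. *)
Lemma horner_v (Q : {poly int}) : (map_poly intr Q).[v] = tofrac (map_poly intr Q).
Proof.
rewrite -[in RHS](comp_polyXr (map_poly intr Q)) /comp_poly -horner_map /=.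
rewrite -!map_poly_comp /v; congr (_.[_]); apply: eq_map_poly => z /=.
by rewrite !rmorph_int.
Qed.

Lemma primes_list m : exists s : seq nat, [/\ uniq s, all prime s & size s = m].
Proof.
elim: m => [|m [s [us ps <-]]]; first by exists [::].
have [p pm pp] := prime_above (\max_(q <- s) q).
exists (p :: s); split=> //=; last by rewrite pp.
rewrite us andbT; apply/negP => psn.
by have := @leq_bigmax_seq _ s xpredT id p psn isT; rewrite /= leqNgt pm.
Qed.

Lemma sqrtC_nat_neq0 (F : finFieldType) : sqrtC #|F|%:R != 0 :> algC.
Proof.
by rewrite sqrtC_eq0 pnatr_eq0 -lt0n; apply/card_gt0P; exists 0.
Qed.

(** A nonzero polynomial has fewer than [size Q] roots, whereas the square roots of [size Q]
    distinct primes are distinct. *)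
Lemma int_poly_sqrt_neq0 (Q : {poly int}) : Q != 0 ->
  exists F : finFieldType, (map_poly intr Q).[sqrtC #|F|%:R] != 0 :> algC.
Proof.
move=> Q0; have [s [us ps ss]] := primes_list (size Q).
have QC0 : map_poly intr Q != 0 :> {poly algC}.
  by rewrite -size_poly_eq0 size_map_inj_poly ?size_poly_eq0 //; exact: intr_inj.
have /allPn[p pinS np] : ~~ all (fun p : nat => root (map_poly intr Q) (sqrtC p%:R : algC)) s.
  apply/negP => rs; have := max_poly_roots QC0 (rs := [seq sqrtC p%:R | p <- s]).
  rewrite all_map rs map_inj_uniq; last first.
    by move=> a b /(congr1 (fun x => x ^+ 2)); rewrite !sqrtCK => /eqP; rewrite eqr_nat => /eqP.
  rewrite us size_map ss size_map_inj_poly ?ltnn //; last exact: intr_inj.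
  by move=> /(_ isT isT).
by exists 'F_p; rewrite card_Fp // (allP ps).
Qed.

(** Cleared of negative exponents, the difference to the constant [a] is a polynomial vanishing at
    every sqrt q, hence zero. *)
Lemma laurent_eval_v (p : laurent) (a : int) :
  (forall F : finFieldType, laurent_eval (sqrtC #|F|%:R) p = a%:~R :> algC) ->
  laurent_eval v p = a%:~R.
Proof.
have [N [Q HQ]] := laurent_poly p => H; pose Q' := Q - a%:P * 'X^N.
have ev (K : fieldType) (x : K) : x != 0 ->
    (map_poly intr Q').[x] = (laurent_eval x p - a%:~R) * x ^+ N.
  move=> x0; rewrite rmorphB rmorphM /= map_polyC map_polyXn hornerD hornerN hornerM.
  by rewrite hornerC hornerXn -HQ // mulrBl.
have Q0 : Q' = 0.
  apply/eqP/contraT => /int_poly_sqrt_neq0[F]; rewrite ev ?sqrtC_nat_neq0 //.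
  by rewrite H subrr mul0r eqxx.
have := ev _ _ v_neq0; rewrite Q0 rmorph0 horner0 => /esym/eqP.
by rewrite mulf_eq0 expf_eq0 (negPf v_neq0) andbF orbF subr_eq0 => /eqP.
Qed.

Lemma laurent_eval_v_neq0 (p : laurent) : laurent_eval v p != 0 ->
  exists F : finFieldType, laurent_eval (sqrtC #|F|%:R) p != 0 :> algC.
Proof.
have [N [Q HQ]] := laurent_poly p => p0.
have /int_poly_sqrt_neq0[F] : Q != 0.
  apply: contra p0 => /eqP Q0; have := HQ _ _ v_neq0; rewrite Q0 rmorph0 horner0 => /eqP.
  by rewrite mulf_eq0 expf_eq0 (negPf v_neq0) andbF orbF.
rewrite -HQ ?sqrtC_nat_neq0 // mulf_eq0 negb_or => /andP[pF _].
by exists F.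
Qed.

Lemma laurent_eval_sqrt_neq0 (F : finFieldType) (p : laurent) :
  laurent_eval (sqrtC #|F|%:R) p != 0 :> algC -> laurent_eval v p != 0.
Proof.
have [N [Q HQ]] := laurent_poly p; apply: contra => /eqP p0.
have := HQ _ _ v_neq0; rewrite p0 mul0r horner_v => /esym/eqP.
rewrite tofrac_eq0 -size_poly_eq0 size_map_inj_poly ?size_poly_eq0 //; last exact: intr_inj.
move=> /eqP Q0; have := HQ _ _ (sqrtC_nat_neq0 F); rewrite Q0 rmorph0 horner0 => /eqP.
by rewrite mulf_eq0 expf_eq0 (negPf (sqrtC_nat_neq0 F)) andbF orbF.
Qed.

Lemma v_exp_inj : injective (fun k : nat => v ^+ k).
Proof.
move=> k l /eqP; rewrite /v -!rmorphXn /= tofrac_eq => /eqP /(congr1 (fun p : {poly rat} => size p)).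
by rewrite !size_polyXn => -[].
Qed.

End Laurent.

(** * Structure constants and generators *)

Lemma sum_only (V : nmodType) (I : finType) (i0 : I) (F : I -> V) :
  (forall i, i != i0 -> F i = 0) -> \sum_i F i = F i0.
Proof. by move=> H; rewrite (bigD1 i0) //= big1 ?addr0. Qed.

(** * Diagonal matrices and row sums *)

Section DiagonalMatrices.
Variables (n d : nat).
Implicit Types X Y Z D : Xi n d.

Definition diagX X := (decor X == set0) && is_diag_mx (intmx X).

Lemma intmx_offdiag X (i j : 'I_n) : i != j ->
  is_diag_mx (intmx X - delta_mx i j) <-> offdiag X [set (i, j)].
Proof.
move=> ij; split=> [/is_diag_mxP H a b ab|oX].
  have := H a b ab; rewrite !mxE inE xpair_eqE.
  by case: (_ && _) => /= /eqP; rewrite ?subr0 ?subr_eq0 => /eqP [].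
apply/is_diag_mxP => a b ab; rewrite !mxE oX // inE xpair_eqE.
by case: (_ && _); rewrite ?subrr.
Qed.

Lemma intmx_diag X : is_diag_mx (intmx X) <-> offdiag X set0.
Proof.
split=> [/is_diag_mxP H a b ab|oX].
  by have := H a b ab; rewrite mxE inE => -[].
by apply/is_diag_mxP => a b ab; rewrite mxE oX // inE.
Qed.

Lemma diagXP X : reflect (decor X = set0 /\ offdiag X set0) (diagX X).
Proof.
apply: (iffP andP) => [[/eqP ? /intmx_diag ?]|[-> /intmx_diag ->]] //.
Qed.

Lemma diag_orbit (F : finFieldType) D (f f' : flag F n d) w : diagX D ->
  in_orbit D f f' w -> f = f' /\ w = 0.
Proof. by move=> /diagXP[dD oD] o; split; [exact: orbit_diag oD o|exact: orbit_decor0 dD o]. Qed.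

Lemma rk_row X (k : 'I_n) : (rk X k.+1 n = rk X k n + \sum_j entry X k j)%N.
Proof.
rewrite !rk_sum (bigID (fun p : 'I_n * 'I_n => p.1 == k)) /= addnC; congr (_ + _)%N.
  apply: eq_bigl => p; rewrite !ltn_ord !andbT -val_eqE /=; lia.
rewrite (reindex_onto (fun j : 'I_n => (k, j)) (fun p => p.2)) /=.
  by apply: eq_bigl => j; rewrite ltnS leqnn ltn_ord !eqxx.
by move=> [a b] /andP[_ /eqP /= ->].
Qed.

(** [rk X k n] is the sum of the first k rows, and the row sums determine the diagonal once the
    other entries are fixed. *)
Lemma rk_inj X Y E : offdiag X E -> offdiag Y E ->
  (forall k, (k <= n)%N -> rk X k n = rk Y k n) -> entry X =2 entry Y.
Proof.
move=> oX oY H a b; have [->|ab] := eqVneq a b; last by rewrite oX // oY.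
have := rk_row X b; have := rk_row Y b; rewrite !H ?(ltnW (ltn_ord b)) // => -> /addnI.
rewrite (bigD1 b) //= [in RHS](bigD1 b) //= (eq_bigr (entry X b)) => [/eqP|j jb].
  by rewrite eqn_add2r => /eqP.
by rewrite oX ?oY // eq_sym.
Qed.

Lemma Nexp_diag X : diagX X -> Nexp X = 0%N.
Proof.
move=> /diagXP[dX oX]; rewrite /Nexp big1 => [|i _].
  rewrite add0n big1 // => i _; rewrite big1 // => j /existsP[p].
  by rewrite dX inE.
rewrite big1 // => j _; rewrite big1 // => k ki; rewrite big1 // => l jl.
have [ij|ij] := eqVneq i j; last by rewrite oX // inE.
rewrite (oX k l) ?inE ?muln0 // -val_eqE /=; move: ki jl; rewrite ij; clear; lia.
Qed.

End DiagonalMatrices.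

(** * Structure constants as numbers of configurations *)

Section StructureConstants.
Variables (n d : nat) (c : Xi n d -> Xi n d -> Xi n d -> laurent).
Hypothesis c_generic : generic_structure c.
Implicit Types X Y Z D : Xi n d.

Lemma convolutionE (F : finFieldType) X Y (f f' : flag F n d) w :
  convolution (@char_fun F n d X) (@char_fun F n d Y) f f' w =
  (\sum_(u : flag F n d * 'rV[F]_d) (in_orbit X f u.1 u.2 && in_orbit Y u.1 f' (w - u.2)))%:R.
Proof.
rewrite /convolution pair_bigA natr_sum; apply: eq_bigr => u _.
by rewrite /char_fun -natrM mulnb.
Qed.

Lemma convolution_neq0 (F : finFieldType) X Y (f f' f'' : flag F n d) w m :
  in_orbit X f f'' m -> in_orbit Y f'' f' (w - m) ->
  convolution (@char_fun F n d X) (@char_fun F n d Y) f f' w != 0.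
Proof.
by move=> oX oY; rewrite convolutionE pnatr_eq0 sum_nat_eq0; apply/forallPn; exists (f'', m);
   rewrite /= oX oY.
Qed.

(* A nonvanishing convolution forces some char_fun Z to be nonzero at (f, f', w),
   which spares the classification of the orbits by normal forms. *)
Lemma covering_generic : covering n d.
Proof.
move=> F f f' f'' w m X Y oX oY; apply/existsP; have := convolution_neq0 oX oY.
rewrite c_generic; apply: contraNT => /existsPn H; rewrite big1 // => Z _.
by rewrite /char_fun (negPf (H Z)) mulr0.
Qed.

(** Orbits are disjoint, so evaluation at a point of the orbit of [Z] isolates one structure
    constant. *)
Lemma convolution_orbit (F : finFieldType) X Y Z (f f' : flag F n d) w : in_orbit Z f f' w ->
  convolution (@char_fun F n d X) (@char_fun F n d Y) f f' w =
  laurent_eval (sqrtC #|F|%:R) (c X Y Z).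
Proof.
move=> oZ; rewrite c_generic (bigD1 Z) //= {1}/char_fun oZ mulr1 big1 ?addr0 // => Z1 ne.
rewrite /char_fun; case: (boolP (in_orbit Z1 f f' w)) => o1; last by rewrite mulr0.
by rewrite (orbit_inj o1 oZ) eqxx in ne.
Qed.

Lemma orbit_exists (F : finFieldType) Z :
  exists (f f' : flag F n d) (w : 'rV[F]_d), in_orbit Z f f' w.
Proof.
have [b b_basis] := label_basis F (card_bidx Z).
have [f cf] := flag_chart_exists (@rowl _ _ Z) b_basis.
have [f' cf'] := flag_chart_exists (@coll _ _ Z) b_basis.
exists f, f', (\sum_(x in firsts Z) b x).
by apply: (chart_orbit (b := b) (card_bidx Z) (labelled_self Z)); split.
Qed.

Definition coef X Y Z : Qv := laurent_eval v (c X Y Z).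

Lemma coef_config X Y Z : coef X Y Z != 0 -> config X Y Z.
Proof.
move=> /laurent_eval_v_neq0[F]; have [f [f' [w oZ]]] := orbit_exists F Z.
rewrite -(convolution_orbit _ _ oZ) convolutionE pnatr_eq0 sum_nat_eq0.
move=> /forallPn[[f'' m]] /=; rewrite eqb0 negbK => /andP[oX oY].
by exists F, f, f', f'', w, m.
Qed.

Lemma config_coef X Y Z : config X Y Z -> coef X Y Z != 0.
Proof.
move=> [F [f [f' [f'' [w [m [oZ oX oY]]]]]]].
apply: (@laurent_eval_sqrt_neq0 F); rewrite -(convolution_orbit _ _ oZ).
exact: convolution_neq0 oX oY.
Qed.

(** Over a point (f, f, 0) the only configuration is f'' = f with vector 0, so the count is 1 for
    every q. *)
Lemma coef_diag D : diagX D -> coef D D D = 1.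
Proof.
move=> dD; apply: (laurent_eval_v (a := 1)) => F.
have [f [f' [w oD]]] := orbit_exists F D; have [ef w0] := diag_orbit dD oD; subst f' w.
rewrite -(convolution_orbit _ _ oD) convolutionE (bigD1 (f, 0)) //= subr0 oD big1 //.
move=> [f'' m] ne; apply/eqP; rewrite eqb0; apply: contra ne => /andP[/= o _].
by have [<- ->] := diag_orbit dD o.
Qed.

End StructureConstants.

(* The scalars are kept abstract here: unification in Q(v) unfolds the
   construction of the fraction field. *)
Section Algebra.
Variables (n d : nat) (K : fieldType) (v : K) (coef : Xi n d -> Xi n d -> Xi n d -> K).
Hypotheses (v_neq0 : v != 0) (v_exp_inj : injective (fun k : nat => v ^+ k)).
Hypothesis coef_config : forall X Y Z, coef X Y Z != 0 -> config X Y Z.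
Hypothesis config_coef : forall X Y Z, config X Y Z -> coef X Y Z != 0.
Hypothesis coef_diag : forall D, diagX D -> coef D D D = 1.
Implicit Types X Y Z D : Xi n d.

Local Notation alg := {ffun Xi n d -> K^o}.

Let e_ X : alg := [ffun Y => (Y == X)%:R].
Let std X : alg := v ^- Nexp X *: e_ X.

Definition alg_mul (x y : alg) : alg :=
  \sum_X \sum_Y \sum_Z (x X * y Y * coef X Y Z) *: e_ Z.

Definition alg_EF (i j : 'I_n) : alg :=
  \sum_(X | (decor X == set0) && is_diag_mx (intmx X - delta_mx i j)) std X.

Definition alg_H (eps : int) (a : 'I_n) : alg :=
  \sum_(X | (decor X == set0) && is_diag_mx (intmx X))
     v ^ (- eps * (entry X a a)%:Z) *: std X.

Definition alg_L (o : 'I_n) : alg :=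
  \sum_(X | (decor X == set0) && is_diag_mx (intmx X)) v ^- (2 * entry X o o) *: std X
  + \sum_(X | (decor X == [set (o, o)]) && is_diag_mx (intmx X)) v ^- entry X o o *: std X.

(** A diagonal undecorated left factor forces f'' = f and m = 0; the row sums are then dimensions in
    the common flag f. *)
Lemma coef_diag_row D Y Z : diagX D -> coef D Y Z != 0 ->
  Y = Z /\ forall k, (k <= n)%N -> rk D k n = rk Y k n.
Proof.
move=> dD /coef_config[F [f [f' [f'' [w [m [oZ oD oY]]]]]]].
have [ef m0] := diag_orbit dD oD; subst f'' m; rewrite subr0 in oY.
split=> [|k kn]; first exact: orbit_inj oY oZ.
by rewrite -(orbit_rk oD) // -(orbit_rk oY) // !space_full.
Qed.

Lemma coef_diag2 D D' Z : diagX D -> diagX D' -> coef D D' Z = ((D == D') && (D == Z))%:R.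
Proof.
move=> dD dD'; have [ne|] := boolP (coef D D' Z != 0); last first.
  rewrite negbK => /eqP c0; case: andP => // -[/eqP eD /eqP eZ]; subst D' Z.
  by move: c0; rewrite coef_diag // => /eqP; rewrite oner_eq0.
have [eZ H] := coef_diag_row dD ne.
have /diagXP[d1 o1] := dD; have /diagXP[d2 o2] := dD'.
have eD : D = D' by apply: Xi_ext; [exact: rk_inj o1 o2 H|rewrite d1 d2].
by subst D' Z; rewrite eqxx coef_diag.
Qed.

Section Subspace.
Variable U : {vspace alg}.
Hypothesis U_mul : forall x y, x \in U -> y \in U -> alg_mul x y \in U.
Hypothesis U_EF : forall i j : 'I_n, (j = i.+1 :> nat) \/ (i = j.+1 :> nat) -> alg_EF i j \in U.
Hypothesis U_H : forall a, alg_H 1 a \in U /\ alg_H (-1) a \in U.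
Hypothesis U_L : forall o : 'I_n, o = 0%N :> nat -> alg_L o \in U.

Lemma scale_eE (a : K) X Z : (a *: e_ X) Z = a * (Z == X)%:R.
Proof. by rewrite !ffunE. Qed.

Lemma coordE (Q : pred (Xi n d)) (a : Xi n d -> K) Z :
  (\sum_(X | Q X) a X *: e_ X) Z = if Q Z then a Z else 0.
Proof.
rewrite sum_ffunE (eq_bigr (fun X => a X * (Z == X)%:R)) => [|X _]; last exact: scale_eE.
case QZ: (Q Z).
  rewrite (bigD1 Z) // eqxx mulr1 big1 => [|X /andP[_ ne]]; first exact: addr0.
  by rewrite eq_sym (negPf ne) mulr0.
rewrite big1 // => X QX; case: eqP => [e|_]; last exact: mulr0.
by rewrite -e QZ in QX.
Qed.

Lemma coord_sum (x : alg) : x = \sum_X x X *: e_ X.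
Proof. by apply/ffunP => Z; apply: esym; exact: (coordE xpredT (fun X => x X) Z). Qed.

Lemma eE X Y : (e_ X : alg) Y = (Y == X)%:R.
Proof. by rewrite ffunE. Qed.

Lemma alg_mulE (x y : alg) (a b : Xi n d -> K) :
  (forall X, x X = a X) -> (forall Y, y Y = b Y) ->
  alg_mul x y = \sum_X \sum_Y (a X * b Y) *: \sum_Z coef X Y Z *: e_ Z.
Proof.
move=> xa yb; apply: eq_bigr => X _; apply: eq_bigr => Y _; rewrite scaler_sumr.
by apply: eq_bigr => Z _; rewrite scalerA xa yb.
Qed.

Lemma e_mul X Y : alg_mul (e_ X) (e_ Y) = \sum_Z coef X Y Z *: e_ Z.
Proof.
rewrite (alg_mulE (eE X) (eE Y)) (sum_only (i0 := X)) => [|X' ne].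
  rewrite (sum_only (i0 := Y)) => [|Y' ne]; first by rewrite !eqxx mulr1 scale1r.
  by rewrite (negPf ne) mulr0 scale0r.
by rewrite big1 // => Y' _; rewrite (negPf ne) mul0r scale0r.
Qed.

Lemma mem_coord (a : Xi n d -> K) Z : \sum_X a X *: e_ X \in U -> a Z != 0 ->
  (forall X, a X != 0 -> X != Z -> e_ X \in U) -> e_ Z \in U.
Proof.
move=> aU aZ H; rewrite -[e_ Z](scalerK aZ); apply: memvZ.
have rest : \sum_(X | X != Z) a X *: e_ X \in U.
  apply: memv_suml => X ne; have [->|aX] := eqVneq (a X) 0; first by rewrite scale0r mem0v.
  by apply: memvZ; exact: H.
by have := memvB aU rest; rewrite (bigD1 Z) // addrK.
Qed.

Lemma product_step X Y Z : e_ X \in U -> e_ Y \in U -> config X Y Z ->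
  (forall Z1, config X Y Z1 -> Z1 != Z -> e_ Z1 \in U) -> e_ Z \in U.
Proof.
move=> XU YU cZ H; have := U_mul XU YU; rewrite e_mul => /mem_coord; apply.
  exact: config_coef.
by move=> Z1 /coef_config c1; exact: H.
Qed.

(** By [coef_diag2] these elements multiply like functions on the diagonal undecorated matrices. *)
Definition diag_comb (g : Xi n d -> K) : alg := \sum_(X | diagX X) g X *: e_ X.

Lemma diag_comb_mul g g' :
  alg_mul (diag_comb g) (diag_comb g') = diag_comb (fun X => g X * g' X).
Proof.
rewrite (alg_mulE (coordE (@diagX n d) g) (coordE (@diagX n d) g')) [RHS]big_mkcond.
apply: eq_bigr => X _; case dX: (diagX X); last first.
  by rewrite big1 // => Y _; rewrite mul0r scale0r.
have EX Y : diagX Y -> \sum_Z coef X Y Z *: e_ Z = (X == Y)%:R *: e_ X.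
  move=> dY; rewrite (sum_only (i0 := X)) => [|Z ne].
    by rewrite (coef_diag2 _ dX dY) eqxx andbT.
  by rewrite (coef_diag2 _ dX dY) [X == Z]eq_sym (negPf ne) andbF scale0r.
rewrite (sum_only (i0 := X)) => [|Y ne]; first by rewrite dX (EX X dX) eqxx scale1r.
case dY: (diagX Y); last by rewrite mulr0 scale0r.
by rewrite (EX Y dY) eq_sym (negPf ne) scale0r scaler0.
Qed.

Lemma diag_comb_lin a g b g' :
  a *: diag_comb g + b *: diag_comb g' = diag_comb (fun X => a * g X + b * g' X).
Proof.
rewrite /diag_comb !scaler_sumr -big_split; apply: eq_bigr => X _.
by rewrite scalerDl !scalerA.
Qed.

Lemma eq_diag_comb g g' : (forall X, diagX X -> g X = g' X) -> diag_comb g = diag_comb g'.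
Proof. by move=> e; apply: eq_bigr => X dX; rewrite e. Qed.

Lemma diag_comb_prod (J : Type) (s : seq J) (R : pred J) (g : J -> Xi n d -> K) :
  diag_comb (fun=> 1) \in U -> (forall j, R j -> diag_comb (g j) \in U) ->
  diag_comb (fun X => \prod_(j <- s | R j) g j X) \in U.
Proof.
move=> U1 H; elim: s => [|j s IH].
  have -> : diag_comb (fun X => \prod_(j <- [::] | R j) g j X) = diag_comb (fun=> 1).
    by apply: eq_diag_comb => X _; rewrite big_nil.
  exact: U1.
have [Rj|/negPf Rj] := boolP (R j).
  have -> : diag_comb (fun X => \prod_(i <- j :: s | R i) g i X) =
      diag_comb (fun X => g j X * \prod_(i <- s | R i) g i X).
    by apply: eq_diag_comb => X _; rewrite big_cons Rj.
  by have := U_mul (H j Rj) IH; rewrite diag_comb_mul.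
have -> : diag_comb (fun X => \prod_(i <- j :: s | R i) g i X) =
    diag_comb (fun X => \prod_(i <- s | R i) g i X).
  by apply: eq_diag_comb => X _; rewrite big_cons Rj.
exact: IH.
Qed.

Lemma genH_comb (eps : int) a :
  alg_H eps a = diag_comb (fun X => v ^ (- eps * (entry X a a)%:Z)).
Proof.
apply: eq_bigr => X dX; rewrite /std Nexp_diag // expr0 invr1 scale1r.
done.
Qed.

Hypothesis n_gt0 : (0 < n)%N.

Lemma one_mem : diag_comb (fun=> 1) \in U.
Proof.
have [Up Um] := U_H (Ordinal n_gt0); have := U_mul Up Um.
rewrite !genH_comb diag_comb_mul; congr (_ \in U); apply: eq_bigr => X _.
by rewrite -expfzDr ?v_neq0 // mulN1r opprK mul1r addNr expr0z.
Qed.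

Lemma entry_le X i j : (entry X i j <= d)%N.
Proof. by rewrite -ltnS; exact: ltn_ord. Qed.

(** This is interpolation. The product of the factors v^(x_aa) - v^k, over all a and all k in [0,d]
    other than the a-th diagonal entry of [D], is nonzero at [D] and vanishes at every other
    diagonal matrix. *)
Lemma idempotent_mem D : diagX D -> e_ D \in U.
Proof.
move=> dD; pose g (p : 'I_n * 'I_d.+1) X : K := v ^+ entry X p.1 p.1 - v ^+ p.2.
pose R (p : 'I_n * 'I_d.+1) := p.2 != entry D p.1 p.1 :> nat.
pose G X := \prod_(p | R p) g p X.
have GU : diag_comb G \in U.
  apply: diag_comb_prod => [|p _]; first exact: one_mem.
  (* The sign -1 gives the coefficients v^(x_aa), and the constant v^k is a multiple of the unit. *)
  have := memvD (memvZ 1 ((U_H p.1).2)) (memvZ (- v ^+ p.2) one_mem).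
  rewrite genH_comb diag_comb_lin; congr (_ \in U); apply: eq_bigr => X _.
  by rewrite mul1r mulr1 opprK mul1r.
have GD : G D != 0.
  apply/prodf_neq0 => p Rp; rewrite subr_eq0 (inj_eq v_exp_inj) eq_sym.
  exact: Rp.
have GX X : diagX X -> X != D -> G X = 0.
  move=> dX ne; have [a na] : exists a, entry X a a != entry D a a.
    apply/existsP; apply: contraT => /existsPn H; case/eqP: ne.
    have /diagXP[d1 o1] := dX; have /diagXP[d2 o2] := dD.
    apply: Xi_ext => [i j|]; last by rewrite d1 d2.
    have [<-|ij] := eqVneq i j; last by rewrite o1 // o2.
    by apply/eqP; have := H i; rewrite negbK.
  have lt : (entry X a a < d.+1)%N by rewrite ltnS entry_le.
  rewrite /G (bigD1 (a, Ordinal lt)) /=; last by rewrite /R /=.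
  by rewrite /g /= subrr mul0r.
have E : diag_comb G = G D *: e_ D.
  by rewrite /diag_comb (bigD1 D) //= big1 ?addr0 // => X /andP[dX ne]; rewrite GX ?scale0r.
by rewrite -[e_ D](scalerK GD) -E; apply: memvZ.
Qed.

(* Left multiplication by the idempotent with the row sums of X keeps the
   coordinates with these row sums and kills all others. *)
Lemma extract X (x : alg) : x \in U -> x X != 0 ->
  (forall Y, x Y != 0 -> Y != X -> (forall k, (k <= n)%N -> rk Y k n = rk X k n) ->
     e_ Y \in U) -> e_ X \in U.
Proof.
move=> xU xX H; have cI := card_bidx X.
have [D lD] := labelled_exists cI (antichain0 (@rowl _ _ X) (@rowl _ _ X)).
have dD : diagX D.
  by apply/diagXP; split; [have [_ -> _] := lD; rewrite imset0|exact: labelled_diag lD].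
have cX : config D X X.
  by apply: (relabel_config cI _ lD (labelled_self X));
    rewrite ?set0U -?setI_eq0 ?set0I //; exact: labelled_self.
have E : alg_mul (e_ D) x = \sum_Y (x Y * coef D Y Y) *: e_ Y.
  rewrite (alg_mulE (eE D) (fun Y => erefl (x Y))) (sum_only (i0 := D)) => [|D' ne]; last first.
    by rewrite big1 // => Y _; rewrite (negPf ne) mul0r scale0r.
  apply: eq_bigr => Y _; rewrite eqxx mul1r -scalerA; congr (_ *: _).
  rewrite (sum_only (i0 := Y)) // => Z ne.
  have [->|/(coef_diag_row dD)[e _]] := eqVneq (coef D Y Z) 0; first by rewrite scale0r.
  by rewrite e eqxx in ne.
have := U_mul (idempotent_mem dD) xU; rewrite E => /mem_coord; apply.
  by rewrite mulf_neq0 ?config_coef.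
move=> Y; rewrite mulf_eq0 negb_or => /andP[xY cY] ne; apply: H => // k kn.
have [_ <-//] := coef_diag_row dD cY.
by have [_ ->//] := coef_diag_row dD (config_coef cX).
Qed.

(** The matrices of one generator share their off-diagonal entries, so the row sums single out
    [X]. *)
Lemma genEF_mem (i j : 'I_n) X : i != j -> alg_EF i j \in U ->
  decor X = set0 -> offdiag X [set (i, j)] -> e_ X \in U.
Proof.
move=> ij gU dX oX.
pose Q Y := (decor Y == set0) && is_diag_mx (intmx Y - delta_mx i j).
have QP Y : Q Y -> decor Y = set0 /\ offdiag Y [set (i, j)].
  by move=> /andP[/eqP dY /(intmx_offdiag _ ij)].
have E Y : alg_EF i j Y = if Q Y then v ^- Nexp Y else 0
  by exact: (coordE Q (fun Y => v ^- Nexp Y)).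
have QX : Q X by rewrite /Q dX eqxx; apply/(intmx_offdiag _ ij).
apply: (extract gU) => [|Y].
  by rewrite E QX invr_neq0 // expf_neq0 // v_neq0.
rewrite E; case: ifP => [/QP[dY oY] _ ne rY|]; last by rewrite eqxx.
by case/eqP: ne; apply: Xi_ext; [exact: rk_inj oY oX rY|rewrite dX].
Qed.

(** The first sum of L consists of multiples of diagonal idempotents, already in [U]; in the second
    one the row sums single out [X]. *)
Lemma genL_mem (o : 'I_n) X : o = 0%N :> nat -> decor X = [set (o, o)] ->
  offdiag X set0 -> e_ X \in U.
Proof.
move=> o0 dX oX; have gU := U_L o0.
pose Q Y := (decor Y == [set (o, o)]) && is_diag_mx (intmx Y).
have QX : Q X by rewrite /Q dX eqxx; apply/intmx_diag.
have E Y : alg_L o Y = (if diagX Y then v ^- (2 * entry Y o o) / v ^+ Nexp Y else 0) +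
    (if Q Y then v ^- entry Y o o / v ^+ Nexp Y else 0).
  rewrite ffunE; congr (_ + _).
    rewrite -(coordE (@diagX n d) (fun Y => v ^- (2 * entry Y o o) / v ^+ Nexp Y)).
    by congr (fun_of_fin _ Y); apply: eq_bigr => Z _; rewrite /std scalerA.
  rewrite -(coordE Q (fun Y => v ^- entry Y o o / v ^+ Nexp Y)).
  by congr (fun_of_fin _ Y); apply: eq_bigr => Z _; rewrite /std scalerA.
have nX : diagX X = false.
  by apply/negP => /diagXP[]; rewrite dX => /setP/(_ (o, o)); rewrite !inE eqxx.
apply: (extract gU) => [|Y].
  by rewrite E QX nX add0r mulf_neq0 // invr_neq0 // expf_neq0 // v_neq0.
rewrite E; case dY: (diagX Y); first by move=> _ _ _; exact: idempotent_mem.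
rewrite add0r; case: ifP => [|_]; last by rewrite eqxx.
move=> /andP[/eqP dY' /intmx_diag oY] _ ne rY; case/eqP: ne.
by apply: Xi_ext; [exact: rk_inj oY oX rY|rewrite dX].
Qed.

Lemma generated_mem : generated (fun X => e_ X \in U).
Proof.
have ne (h h' : 'I_n) : h' = h.+1 :> nat -> h != h'.
  by move=> e; rewrite -val_eqE /= e ltn_eqF.
split=> [X Y Z|X dX oX|X h h' e|X h h' e|X o].
- exact: product_step.
- by apply: idempotent_mem; apply/diagXP.
- by apply: genEF_mem; [exact: ne|by apply: U_EF; left].
- by apply: genEF_mem; [rewrite eq_sym; exact: ne|by apply: U_EF; right].
exact: genL_mem.
Qed.

Lemma mem_generated_subspace x : covering n d -> x \in U.
Proof.
move=> cov; rewrite (coord_sum x); apply: memv_suml => X _; apply: memvZ.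
exact: (generated_all generated_mem cov X).
Qed.

End Subspace.
End Algebra.

Theorem corollary4p2p4 (n d : nat) (n_gt0 : (0 < n)%N) (d_gt0 : (0 < d)%N)
    (c : Xi n d -> Xi n d -> Xi n d -> laurent) (c_generic : generic_structure c) :
  generates (MSmul c) (@generator n d).
Proof.
move=> U U_gen U_mul; apply/vspaceP => x; rewrite memvf.
(* Over Q(v) the abstract product and generators agree by conversion with those of the statement. *)
have := @mem_generated_subspace n d Qv v (coef c) v_neq0 v_exp_inj (@coef_config _ _ _ c_generic)
  (@config_coef _ _ _ c_generic) (@coef_diag _ _ _ c_generic) U U_mul.
apply.
- by move=> i j [e|e]; apply: U_gen; [exact: GenE|exact: GenF].
- by move=> a; split; apply: U_gen; [exact: GenHplus|exact: GenHminus].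
- by move=> o o0; apply: U_gen; exact: GenL.
- exact: n_gt0.
exact: covering_generic c_generic.
Qed.
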